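(* Let $X$ be a Banach space. The following assertions are equivalent: (i) There is $C>0$ such that $\operatorname{cc}(T)\le C\operatorname{wk}_{X^*}(T^* )$ for any operator $T$ from $X$ to a Banach space $Y$. (ii) There is $C>0$ such that $\operatorname{cc}(T)\le C\operatorname{wk}_{X^*}(T^* )$ for any operator $T$ from $X$ to $\ell_\infty$. (iii) There is $C>0$ such that $\limsup_n|x_n^*(x_n)|\le C\operatorname{wk}_{X^*}(\{x_n^*:n\in\mathbb N\})$ whenever $(x_n)$ is a weakly null sequence in $B_X$ and $(x_n^* )$ is a bounded sequence in $X^*$. (iv) There is $C>0$ such that $\operatorname{ca}_{\rho^*}(x_n^* )\le C\delta(x_n^* )$ for any bounded sequence $(x_n^* )$ in $X^*$. (v) There is $C>0$ such that $\widetilde{\operatorname{ca}}_{\rho^*}(x_n^* )\le C\operatorname{wk}_{X^*}(\{x_n^*:n\in\mathbb N\})$ for any bounded sequence $(x_n^* )$ in $X^*$. (vi) There is $C>0$ such that $\operatorname{cc}(T)\le C\operatorname{wk}_{Y}(T)$ for any operator $T$ from $X$ to a Banach space $Y$. (vii) There is $C>0$ such that $\operatorname{cc}(T)\le C\operatorname{wk}_{\ell_\infty}(T)$ for any operator $T$ from $X$ to $\ell_\infty$.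
   Context: Banach spaces are real or complex; $B_X$ is the closed unit ball; operator means bounded linear operator. For a bounded sequence $(z_k)$ in a Banach space, $\operatorname{ca}(z_k)=\inf_{n}\sup_{k,l\ge n}\|z_k-z_l\|$. For an operator $T:X\to Y$, $\operatorname{cc}(T)=\sup\{\operatorname{ca}(Tx_k):(x_k)\text{ is a weakly Cauchy sequence in }B_X\}$. For a bounded subset $A$ of a Banach space $Z$, $\operatorname{wk}_Z(A)=\sup\{\operatorname{dist}(z^{**},Z):z^{**}\in\overline{A}^{w^*}\}$, where $\overline{A}^{w^*}$ is the weak$^*$ closure of $A$ in $Z^{**}$ and $Z$ is canonically embedded in $Z^{**}$. For an operator $T:X\to Y$, $\operatorname{wk}_Y(T)=\operatorname{wk}_Y(T(B_X))$ and $\operatorname{wk}_{X^*}(T^* )=\operatorname{wk}_{X^*}(T^*(B_{Y^*}))$. For a bounded sequence $(z_n)$ in a Banach space $Z$, $\delta(z_n)=\sup_{F}\inf_{n_0}\sup_{i,j\ge n_0}\sup_{z^*\in F}|z^*(z_i-z_j)|$, the first supremum over finite $F\subset B_{Z^*}$; equivalently, the diameter of the set of weak$^*$ cluster points of $(z_n)$ in $Z^{**}$. In (iv) it is taken with $Z=X^*$. For a bounded sequence $(x_n^* )$ in $X^*$, $$\operatorname{ca}_{\rho^*}(x_n^* )=\sup_{F}\inf_{n_0}\sup_{i,j\ge n_0}\sup_{x\in F}|(x_i^*-x_j^* )(x)|,$$ the first supremum over all weakly compact $F\subset B_X$; $\widetilde{\operatorname{ca}}_{\rho^*}(x_n^*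 )$ is the infimum of $\operatorname{ca}_{\rho^*}$ over all subsequences of $(x_n^* )$. *)

(* Defs.v *)
From HB Require Import structures.
From mathcomp Require Import all_boot all_order all_algebra.
From mathcomp Require Import complex lra.
From mathcomp Require Import all_classical all_reals all_analysis.

Set Implicit Arguments.
Unset Strict Implicit.
Unset Printing Implicit Defensive.

Import Order.TTheory GRing.Theory Num.Theory.
Import numFieldNormedType.Exports.

Local Open Scope classical_set_scope.
Local Open Scope ring_scope.

(* Banach spaces over R or over C = R[i] are treated uniformly. The library
   norm of a normedModType K takes its values in K, so that for K = R[i] it is
   a nonnegative "real" element of R[i]; [rnorm] reads it back in R. *)
Inductive scalar_kind := RealScalars | ComplexScalars.

Definition scalars (R : realType) (k : scalar_kind) : numFieldType :=
  match k with RealScalars => R | ComplexScalars => R[i] end.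

Definition to_real (R : realType) (k : scalar_kind) : scalars R k -> R :=
  match k with RealScalars => fun x => x | ComplexScalars => @complex.Re R end.

Definition of_real (R : realType) (k : scalar_kind) : R -> scalars R k :=
  match k with
  | RealScalars => fun x => x
  | ComplexScalars => fun x => Complex x 0
  end.

Section ScalarTheory.
Context (R : realType) (k : scalar_kind).
Local Notation K := (scalars R k).
Local Notation ofR := (@of_real R k).
Local Notation toR := (@to_real R k).

Lemma of_realK : cancel ofR toR.
Proof. by case: k. Qed.

Lemma to_realK (z : K) : 0 <= z -> ofR (toR z) = z.
Proof. by case: k z => //= -[a b] /=; rewrite lecE/= => /andP[/eqP <-]. Qed.

Lemma of_real0 : ofR 0 = 0.
Proof. by case: k. Qed.

Lemma to_real0 : toR 0 = 0.
Proof. by case: k. Qed.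

Lemma of_realD (a b : R) : ofR (a + b) = ofR a + ofR b.
Proof. by case: k => //=; apply/eqP; rewrite eq_complex/= addr0 !eqxx. Qed.

Lemma of_realM (a b : R) : ofR (a * b) = ofR a * ofR b.
Proof.
case: k => //=; apply/eqP; rewrite eq_complex/=.
by rewrite !(mulr0, mul0r, subr0, addr0) !eqxx.
Qed.

Lemma ler_of_real (a b : R) : (ofR a <= ofR b) = (a <= b).
Proof. by case: k => //=; rewrite lecE/= eqxx. Qed.

Lemma gt0_of_real (e : K) : 0 < e -> exists2 r : R, 0 < r & e = ofR r.
Proof.
move=> e0; exists (toR e); last by rewrite to_realK// ltW.
rewrite lt_def -ler_of_real of_real0 to_realK ?ltW// andbT.
apply/eqP => re0; move: (e0).
by rewrite -(to_realK (ltW e0)) re0 of_real0 ltxx.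
Qed.

Lemma of_real_gt0 (r : R) : 0 < r -> 0 < ofR r.
Proof.
move=> r0; rewrite lt_def -of_real0 ler_of_real ltW// andbT.
by rewrite (can_eq of_realK) gt_eqF.
Qed.

End ScalarTheory.

Lemma complex_cauchy_cvg (R : realType)
    (F : set_system (scalars R ComplexScalars)^o) :
  ProperFilter F -> cauchy F -> cvg F.
Proof.
move=> FF /cauchyP cF.
have cpart (p : R[i] -> R) : (forall z w, p (z - w) = p z - p w) ->
    (forall z, `|p z|%:C%C <= `|z|) -> cvg (p @ F).
  move=> pB pN; apply: cauchy_cvg; apply/cauchyP => e e0.
  have [|z Fz] := cF (e%:C%C); first by rewrite ltcR.
  exists (p z); suff: F (p @^-1` ball (p z) e) by [].
  apply: filterS Fz => w; rewrite /preimage/= -!ball_normE => zw.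
  have zwC : `|(z : R[i]) - w| < e%:C%C := zw.
  by have := le_lt_trans (pN _) zwC; rewrite ltcR pB.
have Re_le (z : R[i]) : `|complex.Re z|%:C%C <= `|z| by exact: normc_ge_Re.
have Im_le (z : R[i]) : `|complex.Im z|%:C%C <= `|z|.
  case: z => a b; rewrite normc_def lecR -sqrtr_sqr ler_wsqrtr//=.
  by rewrite lerDr sqr_ge0.
have ReB (z w : R[i]) : complex.Re (z - w) = complex.Re z - complex.Re w.
  by case: z w => ? ? [].
have ImB (z w : R[i]) : complex.Im (z - w) = complex.Im z - complex.Im w.
  by case: z w => ? ? [].
have /cvg_ex[/= a Fa] := cpart _ ReB Re_le.
have /cvg_ex[/= b Fb] := cpart _ ImB Im_le.
apply/cvg_ex; exists (Complex a b); apply/cvgrPdist_lt => e e0.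
have [r r0 ->] := @gt0_of_real R ComplexScalars e e0.
have r20 : 0 < r / 2 by rewrite divr_gt0.
move/cvgrPdist_lt: Fa => /(_ _ r20) Fa; move/cvgrPdist_lt: Fb => /(_ _ r20) Fb.
near=> z.
have Ha : `|a - complex.Re z| < r / 2 by near: z.
have Hb : `|b - complex.Im z| < r / 2 by near: z.
have norm_le (c d : R) : `|Complex c d| <= (`|c| + `|d|)%:C%C.
  have -> : Complex c d = Complex c 0 + Complex 0 d.
    by apply/eqP; rewrite eq_complex/= addr0 add0r !eqxx.
  apply: le_trans (ler_normD _ _) _; rewrite !normc_def/=.
  rewrite expr0n/= addr0 add0r !sqrtr_sqr.
  by rewrite lecE/= addr0 eqxx lexx.
have -> : (Complex a b : (scalars R ComplexScalars)^o) - z =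
    Complex (a - complex.Re z) (b - complex.Im z).
  by case: (z).
apply: le_lt_trans (norm_le _ _) _.
by rewrite /= ltcR [ltRHS]splitr ltrD.
Unshelve. all: by end_near. Qed.

Lemma scalars_cauchy_cvg (R : realType) (k : scalar_kind)
    (F : set_system (scalars R k)^o) :
  ProperFilter F -> cauchy F -> cvg F.
Proof. by case: k F => F; [exact: R_complete|exact: complex_cauchy_cvg]. Qed.

Section RealNorm.
Context (R : realType) (k : scalar_kind).
Local Notation K := (scalars R k).

Definition rnorm (V : normedModType K) (x : V) : R := to_real `|x|.

Definition unit_ball (V : normedModType K) : set V := [set x | `|x| <= 1].

Lemma rnormE (V : normedModType K) (x : V) : of_real k (rnorm x) = `|x|.
Proof. exact: to_realK. Qed.

Lemma rnorm_ge0 (V : normedModType K) (x : V) : 0 <= rnorm x.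
Proof. by rewrite -(ler_of_real k) rnormE of_real0. Qed.

Lemma rnorm0 (V : normedModType K) : rnorm (0 : V) = 0.
Proof. by rewrite /rnorm normr0 to_real0. Qed.

Lemma rnorm_eq0 (V : normedModType K) (x : V) : rnorm x = 0 -> x = 0.
Proof. by move=> x0; apply/normr0_eq0; rewrite -rnormE x0 of_real0. Qed.

Lemma rnormD (V : normedModType K) (x y : V) :
  rnorm (x + y) <= rnorm x + rnorm y.
Proof. by rewrite -(ler_of_real k) of_realD !rnormE ler_normD. Qed.

Lemma rnormZ (V : normedModType K) (a : K) (x : V) :
  rnorm (a *: x) = rnorm (a : K^o) * rnorm x.
Proof.
by apply: (can_inj (@of_realK R k)); rewrite of_realM !rnormE normrZ.
Qed.

End RealNorm.

Arguments unit_ball {R k} V.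

Section SupNorm.
Context (R : realType) (k : scalar_kind) (I : pointedType) (A : set I).
Context (V : normedModType (scalars R k)).
Hypothesis A0 : A !=set0.

Definition sup_norm (f : I -> V) : R := sup [set rnorm (f i) | i in A].

Definition sup_bounded (f : I -> V) : Prop :=
  exists M : R, forall i, A i -> rnorm (f i) <= M.

Lemma sup_norm_has_sup (f : I -> V) :
  sup_bounded f -> has_sup [set rnorm (f i) | i in A].
Proof.
move=> [M fM]; split; first by case: A0 => i Ai; exists (rnorm (f i)), i.
by exists M => _ [i Ai <-]; exact: fM.
Qed.

Lemma sup_norm_ub (f : I -> V) i : sup_bounded f -> A i ->
  rnorm (f i) <= sup_norm f.
Proof.
move=> /sup_norm_has_sup[_ ubf] Ai; apply: ub_le_sup => //.
by exists i.
Qed.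

Lemma sup_norm_le (f : I -> V) (M : R) :
  (forall i, A i -> rnorm (f i) <= M) -> sup_norm f <= M.
Proof.
move=> fM; apply: ge_sup; first by case: A0 => i Ai; exists (rnorm (f i)), i.
by move=> _ [i Ai <-]; exact: fM.
Qed.

Lemma sup_normD (f g : I -> V) : sup_bounded f -> sup_bounded g ->
  sup_norm (fun i => f i + g i) <= sup_norm f + sup_norm g.
Proof.
move=> bf bg; apply: sup_norm_le => i Ai; apply: le_trans (rnormD _ _) _.
by apply: lerD; exact: sup_norm_ub.
Qed.

Lemma sup_normZ_le (a : scalars R k) (f : I -> V) : sup_bounded f ->
  sup_norm (fun i => a *: f i) <= rnorm (a : (scalars R k)^o) * sup_norm f.
Proof.
move=> bf; apply: sup_norm_le => i Ai; rewrite rnormZ.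
by apply: ler_wpM2l; [exact: rnorm_ge0|exact: sup_norm_ub].
Qed.

Lemma sup_norm_ge0 (f : I -> V) : sup_bounded f -> 0 <= sup_norm f.
Proof.
by case: A0 => i Ai bf; apply: le_trans (rnorm_ge0 _) (sup_norm_ub bf Ai).
Qed.

Lemma sup_boundedZ (a : scalars R k) (f : I -> V) :
  sup_bounded f -> sup_bounded (fun i => a *: f i).
Proof.
move=> [M fM]; exists (rnorm (a : (scalars R k)^o) * M) => i Ai.
by rewrite rnormZ; apply: ler_wpM2l; [exact: rnorm_ge0|exact: fM].
Qed.

Lemma sup_boundedD (f g : I -> V) :
  sup_bounded f -> sup_bounded g -> sup_bounded (fun i => f i + g i).
Proof.
move=> [M fM] [N gN]; exists (M + N) => i Ai.
by apply: le_trans (rnormD _ _) _; apply: lerD; [exact: fM|exact: gN].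
Qed.

Lemma sup_normZ (a : scalars R k) (f : I -> V) : sup_bounded f ->
  sup_norm (fun i => a *: f i) = rnorm (a : (scalars R k)^o) * sup_norm f.
Proof.
move=> bf; apply/eqP; rewrite eq_le sup_normZ_le//=.
have [->|a0] := eqVneq a 0.
  rewrite rnorm0 mul0r; apply: sup_norm_ge0.
  exact: sup_boundedZ.
have ap : 0 < rnorm (a : (scalars R k)^o).
  rewrite lt_def rnorm_ge0 andbT; apply: contra a0 => /eqP/rnorm_eq0 ->//.
rewrite mulrC -ler_pdivlMr//; apply: sup_norm_le => i Ai.
rewrite ler_pdivlMr// mulrC -rnormZ.
exact: (sup_norm_ub (sup_boundedZ a bf)).
Qed.

End SupNorm.

Section Operators.
Context (R : realType) (k : scalar_kind).
Local Notation K := (scalars R k).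

Definition bounded_operator (X Y : normedModType K) : {pred X -> Y} :=
  mem [set T : X -> Y | linear T /\ continuous T].

Record operator (X Y : normedModType K) := Operator {
  operator_fun :> X -> Y;
  operatorP : operator_fun \in @bounded_operator X Y }.

End Operators.

Section OperatorSpace.
Context (R : realType) (k : scalar_kind).
Local Notation K := (scalars R k).
Context (X Y : normedModType K).

HB.instance Definition _ := [isSub for @operator_fun R k X Y].
HB.instance Definition _ := [Choice of operator X Y by <:].

Lemma bounded_operator_submod : submod_closed (@bounded_operator R k X Y).
Proof.
split=> [|a f g /set_mem[lf cf] /set_mem[lg cg]]; apply/mem_set; split.
- by move=> a u v; rewrite /= scaler0 addr0.
- by move=> x; exact: cst_continuous.
- move=> b u v; rewrite -[LHS]/(a *: f (b *: u + v) + g (b *: u + v)).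
  rewrite lf lg !scalerDr !scalerA addrACA.
  by rewrite (mulrC a b).
- move=> x; apply: (@continuousD K Y X (a *: f) g); last exact: cg.
  by apply: (@continuousZl_tmp K Y X f a); exact: cf.
Qed.

HB.instance Definition _ := GRing.isSubmodClosed.Build K (X -> Y)
  (@bounded_operator R k X Y) bounded_operator_submod.
HB.instance Definition _ := [SubChoice_isSubLmodule of operator X Y by <:].

Lemma operator_linear (T : operator X Y) : linear T.
Proof. by have /set_mem[] := operatorP T. Qed.

HB.instance Definition _ (T : operator X Y) :=
  GRing.isLinear.Build K X Y *:%R (operator_fun T) (operator_linear T).

Lemma operator_continuous (T : operator X Y) : continuous T.
Proof. by have /set_mem[] := operatorP T. Qed.

Lemma unit_ball_nonempty : (@unit_ball R k X) !=set0.
Proof. by exists 0; rewrite /unit_ball/= normr0 ler01. Qed.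

Lemma operator_bounded (T : operator X Y) : sup_bounded (@unit_ball R k X) T.
Proof.
have /linear_bounded_continuous/bounded_funP/(_ 1)[M bM] :=
  @operator_continuous T.
exists (to_real M) => x /bM TM.
by rewrite -(ler_of_real k) rnormE to_realK// (le_trans _ TM).
Qed.

Definition operator_norm (T : operator X Y) : K :=
  of_real k (sup_norm (@unit_ball R k X) T).

Lemma ler_operator_normD (S T : operator X Y) :
  operator_norm (S + T) <= operator_norm S + operator_norm T.
Proof.
rewrite -of_realD ler_of_real.
by apply: sup_normD; [exact: unit_ball_nonempty|exact: operator_bounded..].
Qed.

Lemma operator_normZ (a : K) (T : operator X Y) :
  operator_norm (a *: T) = `|a| * operator_norm T.
Proof.
rewrite -(rnormE (a : K^o)) -of_realM; congr of_real.
by apply: sup_normZ; [exact: unit_ball_nonempty|exact: operator_bounded].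
Qed.

Lemma operator_norm0_eq0 (T : operator X Y) : operator_norm T = 0 -> T = 0.
Proof.
rewrite -(of_real0 R k) => /(can_inj (@of_realK R k)).
rewrite -[LHS]/(sup_norm _ _) => T0.
apply/val_inj/funext => x /=; have [->|x0] := eqVneq x 0; first exact: linear0.
have xB : unit_ball X (`|x|^-1 *: x) by rewrite /unit_ball/= normfZV.
have /rnorm_eq0 : rnorm (T (`|x|^-1 *: x)) = 0.
  apply/eqP; rewrite eq_le rnorm_ge0 andbT -T0.
  exact: (sup_norm_ub unit_ball_nonempty (operator_bounded T) xB).
rewrite linearZ => /eqP; rewrite scaler_eq0 invr_eq0 normr_eq0 (negPf x0)/=.
by move=> /eqP.
Qed.

HB.instance Definition _ := @Lmodule_isNormed.Build K (operator X Y)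
  operator_norm ler_operator_normD operator_normZ operator_norm0_eq0.

End OperatorSpace.

Arguments operator {R k} X Y.

Notation dual X := (operator X (scalars _ _)^o).

Section Adjoint.
Context (R : realType) (k : scalar_kind).
Local Notation K := (scalars R k).

Lemma ler_operator_norm (X Y : normedModType K) (T : operator X Y) (x : X) :
  `|T x| <= `|T| * `|x|.
Proof.
have [->|x0] := eqVneq x 0; first by rewrite linear0 !normr0 mulr0.
have xB : unit_ball X (`|x|^-1 *: x) by rewrite /unit_ball/= normfZV.
have := sup_norm_ub (@unit_ball_nonempty R k X) (operator_bounded T) xB.
rewrite -(ler_of_real k) rnormE linearZ normrZ normfV normr_id => Tx.
by rewrite mulrC -ler_pdivrMl ?normr_gt0.
Qed.

Lemma operator_norm_le (X Y : normedModType K) (T : operator X Y) (M : K) :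
  (forall x, `|T x| <= M * `|x|) -> 0 <= M -> `|T| <= M.
Proof.
move=> TM M0; rewrite -(to_realK M0) [leLHS]/(of_real _ _) ler_of_real.
apply: sup_norm_le; first exact: unit_ball_nonempty.
move=> x x1; rewrite -(ler_of_real k) rnormE to_realK//.
by apply: le_trans (TM x) _; rewrite ler_piMr.
Qed.

Lemma bounded_operatorP (X Y : normedModType K) (f : X -> Y) (M : K) :
  linear f -> 0 <= M -> (forall x, `|f x| <= M * `|x|) ->
  f \in @bounded_operator R k X Y.
Proof.
move=> lin_f M0 fM; apply/mem_set; split=> //.
pose g : {linear X -> Y} :=
  HB.pack f (GRing.isLinear.Build _ _ _ _ f lin_f).
apply: (@bounded_linear_continuous _ _ _ g); apply/bounded_funP => r.
by exists (M * r) => x xr; apply: le_trans (fM x) _; rewrite ler_wpM2l.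
Qed.

Lemma comp_operator_subproof (X Y Z : normedModType K) (S : operator Y Z)
  (T : operator X Y) : S \o T \in @bounded_operator R k X Z.
Proof.
apply/mem_set; split=> [a x y|x] /=; first by rewrite !linearP.
by apply: continuous_comp; exact: operator_continuous.
Qed.

Definition comp_operator (X Y Z : normedModType K) (S : operator Y Z)
  (T : operator X Y) : operator X Z := Operator (comp_operator_subproof S T).

Lemma adjoint_subproof (X Y : normedModType K) (T : operator X Y) :
  (fun g : dual Y => comp_operator g T : dual X)
    \in @bounded_operator R k (dual Y) (dual X).
Proof.
apply: (@bounded_operatorP _ _ _ `|T|) => // [a f g|g]; first exact: val_inj.
apply: operator_norm_le; last exact: mulr_ge0.
move=> x; apply: le_trans (ler_operator_norm g (T x)) _.
by rewrite -mulrA mulrCA ler_wpM2l// ler_operator_norm.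
Qed.

Definition adjoint (X Y : normedModType K) (T : operator X Y) :
  operator (dual Y) (dual X) := Operator (adjoint_subproof T).

Lemma canonical_embedding_subproof (X : normedModType K) (x : X) :
  (fun f : dual X => f x) \in @bounded_operator R k (dual X) K^o.
Proof.
apply: (@bounded_operatorP _ _ _ `|x|) => // f.
by rewrite mulrC ler_operator_norm.
Qed.

Definition canonical_embedding (X : normedModType K) (x : X) : dual (dual X) :=
  Operator (canonical_embedding_subproof x).

End Adjoint.

Section EllInfty.
Context (R : realType) (k : scalar_kind).
Local Notation K := (scalars R k).

Definition bounded_sequence : {pred nat -> K^o} :=
  mem [set u : nat -> K^o | bounded_fun u].

Record ell_infty := EllInfty {
  ell_infty_seq :> nat -> K^o;
  ell_inftyP : ell_infty_seq \in bounded_sequence }.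

HB.instance Definition _ := [isSub for ell_infty_seq].
HB.instance Definition _ := [Choice of ell_infty by <:].

Lemma bounded_sequenceP (u : nat -> K^o) :
  u \in bounded_sequence <-> sup_bounded [set: nat] u.
Proof.
have PF : ProperFilter (globally [set: nat]).
  exact: (@globally_properfilter _ _ 0%N).
split=> [/set_mem/ex_bound[M uM]|[M uM]].
  exists (to_real M) => i _; rewrite -(ler_of_real k) rnormE.
  have uiM : `|u i| <= M by exact: uM.
  by rewrite to_realK// (le_trans _ uiM).
apply/mem_set; apply/(@ex_bound _ _ K^o u); exists (of_real k M) => i _ /=.
by rewrite -rnormE ler_of_real; exact: uM.
Qed.

Lemma bounded_sequence_submod : submod_closed bounded_sequence.
Proof.
split=> [|a u v /bounded_sequenceP bu /bounded_sequenceP bv].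
  by apply/bounded_sequenceP; exists 0 => i _; rewrite rnorm0.
apply/bounded_sequenceP.
exact: (sup_boundedD (sup_boundedZ a bu) bv).
Qed.

HB.instance Definition _ := GRing.isSubmodClosed.Build K (nat -> K^o)
  bounded_sequence bounded_sequence_submod.
HB.instance Definition _ := [SubChoice_isSubLmodule of ell_infty by <:].

Let setT_nonempty : [set: nat] !=set0. Proof. by exists 0%N. Qed.

Let bounded (u : ell_infty) : sup_bounded [set: nat] u.
Proof. exact/bounded_sequenceP/ell_inftyP. Qed.

Definition ell_infty_norm (u : ell_infty) : K :=
  of_real k (sup_norm [set: nat] u).

Lemma ler_ell_infty_normD (u v : ell_infty) :
  ell_infty_norm (u + v) <= ell_infty_norm u + ell_infty_norm v.
Proof. by rewrite -of_realD ler_of_real; exact: sup_normD. Qed.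

Lemma ell_infty_normZ (a : K) (u : ell_infty) :
  ell_infty_norm (a *: u) = `|a| * ell_infty_norm u.
Proof.
rewrite -(rnormE (a : K^o)) -of_realM; congr of_real.
exact: sup_normZ.
Qed.

Lemma ell_infty_norm0_eq0 (u : ell_infty) : ell_infty_norm u = 0 -> u = 0.
Proof.
rewrite -(of_real0 R k) => /(can_inj (@of_realK R k)).
rewrite -[LHS]/(sup_norm _ _) => u0.
apply/val_inj/funext => i /=; apply: rnorm_eq0.
apply/eqP; rewrite eq_le rnorm_ge0 andbT -u0.
exact: (sup_norm_ub setT_nonempty (bounded u)).
Qed.

HB.instance Definition _ := @Lmodule_isNormed.Build K ell_infty
  ell_infty_norm ler_ell_infty_normD ell_infty_normZ ell_infty_norm0_eq0.

Lemma ell_infty_cauchy_cvg (F : set_system ell_infty) :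
  ProperFilter F -> cauchy F -> cvg F.
Proof.
move=> FF /cauchyP cF.
have ler_coord (u : ell_infty) i : `|u i : K^o| <= `|u|.
  rewrite -[leRHS]/(of_real _ _) -rnormE ler_of_real.
  by apply: sup_norm_ub.
have ell_norm_le (u : ell_infty) (r : R) :
    (forall i, `|u i : K^o| <= of_real k r) -> `|u| <= of_real k r.
  move=> ur; rewrite -[leLHS]/(of_real _ _) ler_of_real.
  apply: sup_norm_le; first by exists 0%N.
  by move=> i _; rewrite -(ler_of_real k) rnormE.
have cvg_coord i : cvg ((fun u : ell_infty => u i) @ F).
  apply: scalars_cauchy_cvg; apply/cauchyP => e e0.
  have [u Fu] := cF e e0; exists (u i).
  suff: F ((fun u => u i) @^-1` ball (u i : K^o) e) by [].
  apply: filterS Fu => v; rewrite /preimage/= -!ball_normE.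
  by apply: le_lt_trans; exact: (ler_coord (u - v)).
pose l i : K^o := lim ((fun u : ell_infty => u i) @ F).
have near_l (r : R) : 0 < r -> exists2 v : ell_infty,
    F (ball v (of_real k (r / 3))) & forall u, ball v (of_real k (r / 3)) u ->
    forall i, `|l i - u i| <= of_real k r.
  move=> r0; have r3 := of_real_gt0 k (divr_gt0 r0 (ltr0n R 3)).
  have [v Fv] := cF _ r3; exists v => // u vu i.
  have li : F [set w : ell_infty | `|l i - w i| < of_real k (r / 3)].
    by have /cvgrPdist_lt/(_ _ r3) := cvg_coord i.
  have [w [vw lw]] := filter_ex (filterI Fv li).
  have -> : l i - u i = (l i - w i) - (v - w) i + (v - u) i.
    rewrite -[(v - w) i]/(v i - w i) -[(v - u) i]/(v i - u i).
    by rewrite opprB subrKA subrKA.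
  have -> : r = r / 3 + r / 3 + r / 3 by lra.
  rewrite !of_realD; apply: le_trans (ler_normD _ _) _.
  apply: lerD; last first.
    by apply: le_trans (ler_coord _ _) _; move: vu; rewrite -ball_normE => /ltW.
  apply: le_trans (ler_normB _ _) _; apply: lerD; first exact: ltW.
  by apply: le_trans (ler_coord _ _) _; move: vw; rewrite -ball_normE => /ltW.
have l_bounded : l \in bounded_sequence.
  have [v Fv vl] := near_l 1 ltr01; apply/bounded_sequenceP.
  have r3 := of_real_gt0 k (divr_gt0 (@ltr01 R) (ltr0n R 3)).
  exists (1 + rnorm v) => i _; rewrite -(ler_of_real k) of_realD !rnormE.
  rewrite -[l i](subrK (v i)); apply: le_trans (ler_normD _ _) _.
  by apply: lerD => //; apply: vl; exact: ballxx.
apply/cvg_ex; exists (EllInfty l_bounded).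
apply/cvgrPdist_le => e /gt0_of_real[r r0 ->].
have [v Fv vl] := near_l r r0; apply: filterS Fv => u vu.
by apply: ell_norm_le => i; exact: vl.
Qed.
HB.instance Definition _ := Uniform_isComplete.Build ell_infty ell_infty_cauchy_cvg.

End EllInfty.

Section WeakTopologies.
Context (R : realType) (k : scalar_kind) (X : normedModType (scalars R k)).
Local Notation K := (scalars R k).

Definition weak : topologicalType :=
  initial_topology (fun x : X =>
    (fun f => f x) : prod_topology (fun _ : dual X => K^o)).

Definition weak_star : topologicalType :=
  initial_topology (fun f : dual X =>
    (f : X -> K^o) : prod_topology (fun _ : X => K^o)).

Definition weakly_cauchy (x : nat -> X) : Prop :=
  forall f : dual X, cauchy (f (x n) @[n --> \oo]).

Definition weakly_null (x : nat -> X) : Prop :=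
  forall f : dual X, f (x n) @[n --> \oo] --> (0 : K^o).

Definition weakly_compact (F : set X) : Prop := compact (F : set weak).

End WeakTopologies.

(* All quantities below are suprema and infima in \bar R. The inner index sets
   such as {(i, j) | n0 <= i, j} are nonempty; suprema over an empty F are -oo,
   which does not affect the outer supremum over all F. *)
Section Quantities.
Context (R : realType) (k : scalar_kind).
Local Notation K := (scalars R k).
Local Open Scope ereal_scope.

Definition tail_osc (a : nat -> nat -> \bar R) : \bar R :=
  ereal_inf [set ereal_sup [set a i j | i in [set i | (n0 <= i)%N]
                                      & j in [set j | (n0 <= j)%N]]
            | n0 in [set: nat]].

Definition ca (Z : normedModType K) (z : nat -> Z) : \bar R :=
  tail_osc (fun i j => (rnorm (z i - z j))%:E).

Definition cc (X Y : normedModType K) (T : operator X Y) : \bar R :=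
  ereal_sup [set ca (T \o x) | x in
    [set x : nat -> X | weakly_cauchy x /\ forall n, unit_ball X (x n)]].

Definition dist_to_space (Z : normedModType K) (z : dual (dual Z)) : \bar R :=
  ereal_inf [set (rnorm (z - canonical_embedding y))%:E | y in [set: Z]].

Definition wk (Z : normedModType K) (A : set Z) : \bar R :=
  ereal_sup [set dist_to_space z | z in
    closure (@canonical_embedding R k Z @` A : set (weak_star (dual Z)))].

Definition wk_op (X Y : normedModType K) (T : operator X Y) : \bar R :=
  wk (T @` unit_ball X).

Definition delta (Z : normedModType K) (z : nat -> Z) : \bar R :=
  ereal_sup [set tail_osc (fun i j =>
      ereal_sup [set (rnorm (f (z i - z j)))%:E | f in F])
    | F in [set F : set (dual Z) | finite_set F /\ F `<=` unit_ball (dual Z)]].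

Definition ca_rho_star (X : normedModType K) (f : nat -> dual X) : \bar R :=
  ereal_sup [set tail_osc (fun i j =>
      ereal_sup [set (rnorm ((f i - f j) x))%:E | x in F])
    | F in [set F : set X | weakly_compact F /\ F `<=` unit_ball X]].

Definition ca_rho_star_tilde (X : normedModType K) (f : nat -> dual X) : \bar R :=
  ereal_inf [set ca_rho_star (f \o phi)
    | phi in [set phi : nat -> nat | {homo phi : m n / (m < n)%N}]].

End Quantities.

(* Main.v *)
Require Import Defs.
From HB Require Import structures.
From mathcomp Require Import all_boot all_order all_algebra.
From mathcomp Require Import complex ring lra.
From mathcomp Require Import all_classical all_reals all_analysis.

Set Implicit Arguments.
Unset Strict Implicit.
Unset Printing Implicit Defensive.

Import Order.TTheory GRing.Theory Num.Theory.
Import numFieldNormedType.Exports.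

Local Open Scope classical_set_scope.
Local Open Scope ring_scope.

(** The pivot of the equivalence is the bound of [limsup |f_n (x_n)|], for
    [x] weakly null in the ball and [f] bounded in the dual, by the weak
    noncompactness of the set of the [f_n] ([weakly_null_bound]).

    All other bounds follow from it. If [T] oscillates along a weakly Cauchy
    sequence, differences of terms form a weakly null sequence [x], and
    functionals [y_n] norming [T x_n] give [f_n = T^* y_n] in the image of the
    dual ball, with [|f_n (x_n)| = |T x_n|]. This bounds [cc T] by [wk_op] of
    the adjoint, and Gantmacher's theorem in the form
    [wk_op (adjoint T) <= 2 wk_op T] ([wk_adjoint_le]) turns it into a bound
    by [wk_op T]. If the [f_i - f_j] are large at points of a weakly compact
    set, these points may be taken weakly convergent; [delta f] controls the
    differences at the limit point, so they remain large at a weakly null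
    sequence.

    Two ideas lead back. The first is a quantitative Eberlein-Smulian theorem
    ([quantitative_eberlein_smulian]): a bounded sequence whose range has weak
    noncompactness less than [w] has a subsequence with [delta] at most [9 w].
    It turns a bound by [delta] into a bound by weak noncompactness along a
    subsequence; as a weakly null sequence together with 0 is weakly compact,
    the latter gives the pivot again. The second derives the pivot from the
    bound of [cc T] for operators into the bounded sequences. The obvious
    operator [x |-> (f_n x)_n] would call for a quantitative Krein theorem on
    the convex hull of the [f_n]. Passing to a subsequence given by the first
    idea and taking differences [g] of its terms avoids this: now every
    weak-star cluster point of [g] is small, and a Yosida-Hewitt splitting of
    the functionals on bounded sequences ([functional_tail]) shows that
    [x |-> (g_n x)_n] has small weak noncompactness ([sequence_operator]). The
    subtracted terms are chosen nearly null at the points where the original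
    ones are large.

    Functionals come from the Hahn-Banach theorem for seminorms, and elements
    of a bidual from limits along ultrafilters. *)

(** * The Hahn-Banach theorem for seminorms *)

Section HahnBanach.
Context (R : realType) (k : scalar_kind).
Local Notation K := (scalars R k).
Local Notation ofR := (@of_real R k).

Lemma of_real1 : ofR 1 = 1.
Proof. by case: k. Qed.

Lemma of_realN (a : R) : ofR (- a) = - ofR a.
Proof. by case: k => //=; apply/eqP; rewrite eq_complex/= oppr0 !eqxx. Qed.

Lemma rnorm_of_real (a : R) : rnorm (ofR a : K^o) = `|a|.
Proof.
apply: (can_inj (@of_realK R k)); rewrite rnormE.
have [a0|/ltW a0] := leP 0 a.
  have a0K : 0 <= ofR a by rewrite -(of_real0 R k) ler_of_real.
  by rewrite (ger0_norm a0) (ger0_norm a0K).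
have a0K : ofR a <= 0 by rewrite -(of_real0 R k) ler_of_real.
by rewrite (ler0_norm a0) (ler0_norm a0K) of_realN.
Qed.

Lemma rnorm1 : rnorm (1 : K^o) = 1.
Proof. by rewrite -of_real1 rnorm_of_real normr1. Qed.

Lemma rnormN (W : normedModType K) (x : W) : rnorm (- x) = rnorm x.
Proof. by rewrite /rnorm normrN. Qed.

(** Homogeneity is stated as an inequality, which passes directly to infima;
    rescaling gives the reverse one. *)
Definition sublinear (V : lmodType K) (q : V -> R) : Prop :=
  (forall x y, q (x + y) <= q x + q y) /\
  (forall t x, 0 <= t -> q (ofR t *: x) <= t * q x).

Definition seminorm (V : lmodType K) (p : V -> R) : Prop :=
  (forall x y, p (x + y) <= p x + p y) /\
  (forall (a : K) x, p (a *: x) <= rnorm (a : K^o) * p x).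

Section Sublinear.
Context (V : lmodType K).
Implicit Types (q p : V -> R) (x y : V).

Lemma sublinear0 q : sublinear q -> q 0 = 0.
Proof.
move=> [qD qZ]; apply/eqP; rewrite eq_le; apply/andP; split.
  by have := qZ 0 0 (lexx 0); rewrite scaler0 mul0r.
by have := qD 0 0; rewrite addr0 -{1}[q 0]addr0 lerD2l.
Qed.

Lemma sublinearZ q t x : sublinear q -> 0 <= t -> q (ofR t *: x) = t * q x.
Proof.
move=> sq; rewrite le_eqVlt => /predU1P[<-|t0].
  by rewrite of_real0 scale0r mul0r sublinear0.
apply/eqP; rewrite eq_le; apply/andP; split; first by apply: sq.2; exact: ltW.
rewrite -ler_pdivlMl//.
have := sq.2 t^-1 (ofR t *: x); rewrite scalerA -of_realM mulVf ?gt_eqF//.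
by rewrite of_real1 scale1r; apply; rewrite invr_ge0 ltW.
Qed.

Lemma sublinear_oppr_ge q x : sublinear q -> - q (- x) <= q x.
Proof.
move=> sq; rewrite lerNl -subr_ge0 opprK addrC -(sublinear0 sq) -(subrr x).
exact: sq.1.
Qed.

(** A sublinear functional that is not additive in the direction [y] lies
    strictly above another one, its directional infimum along [y]. *)
Lemma sublinear_directional q y : sublinear q ->
  exists q', [/\ sublinear q', forall x, q' x <= q x &
    forall x, q' x <= q (x + y) - q y].
Proof.
move=> sq.
pose S x := [set q (x + ofR t *: y) - t * q y | t in [set t | 0 <= t]].
have lbS x z : S x z -> - q (- x) <= z.
  move=> [t /= t0 <-]; rewrite lerBrDr -(sublinearZ _ sq t0) addrC lerBlDr.
  by have := sq.1 (x + ofR t *: y) (- x); rewrite addrC addKr.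
have S0 x t : 0 <= t -> inf (S x) <= q (x + ofR t *: y) - t * q y.
  by move=> t0; apply: ge_inf; [exists (- q (- x)) => z /lbS|exists t].
have SN x : S x !=set0 by exists (q (x + ofR 0 *: y) - 0 * q y), 0 => //=.
exists (fun x => inf (S x)); split.
- split=> [x1 x2|l x l0].
    rewrite -lerBlDr; apply: lb_le_inf => // _ [s /= s0 <-].
    rewrite lerBlDr -lerBlDl; apply: lb_le_inf => // _ [t /= t0 <-].
    rewrite lerBlDl; apply: le_trans (S0 _ (s + t) (addr_ge0 s0 t0)) _.
    have := sq.1 (x1 + ofR s *: y) (x2 + ofR t *: y).
    by rewrite of_realD scalerDl addrACA; lra.
  move: l0; rewrite le_eqVlt => /predU1P[<-|l0].
    apply: le_trans (S0 _ 0 (lexx 0)) _.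
    by rewrite of_real0 !scale0r add0r !mul0r sublinear0// subr0.
  rewrite -ler_pdivrMl//; apply: lb_le_inf => // _ [t /= t0 <-].
  rewrite ler_pdivrMl//.
  apply: le_trans (S0 _ (l * t) (mulr_ge0 (ltW l0) t0)) _.
  rewrite of_realM -scalerA -scalerDr (sublinearZ _ sq (ltW l0)).
  by rewrite -mulrA mulrBr.
- move=> x; apply: le_trans (S0 x 0 (lexx 0)) _.
  by rewrite of_real0 scale0r addr0 mul0r subr0.
- move=> x; apply: le_trans (S0 x 1 ler01) _.
  by rewrite of_real1 scale1r mul1r.
Qed.

(** The pointwise infimum of a chain of sublinear functionals below [p] is
    finite, as they are all at least [- p (- x)], so Zorn's lemma applies. *)
Lemma minimal_sublinear p : sublinear p ->
  exists q, [/\ sublinear q, forall x, q x <= p x &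
    forall q', sublinear q' -> (forall x, q' x <= q x) -> q' = q].
Proof.
move=> sp; pose T := {q : V -> R | sublinear q /\ forall x, q x <= p x}.
have t0 : T by exists p.
pose Rel (q1 q2 : T) := `[< forall x, sval q2 x <= sval q1 x >].
have Rrefl t : Rel t t by apply/asboolP.
have Rtrans r s t : Rel r s -> Rel s t -> Rel r t.
  by move=> /asboolP rs /asboolP st; apply/asboolP => x; exact: le_trans (rs x).
have [|[q [sq qp]] qmin] := @ZL_preorder T t0 Rel Rrefl Rtrans; last first.
  exists q; split=> // q' sq' q'q.
  have q'p x : q' x <= p x by exact: le_trans (qp x).
  have /asboolP/= qq' := qmin (exist _ q' (conj sq' q'p)) (asboolT q'q).
  by apply/funext => x; apply/eqP; rewrite eq_le q'q qq'.
move=> A Atot; have [[q0 Aq0]|A0] := pselect (A !=set0); last first.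
  by exists t0 => s As; exfalso; apply: A0; exists s.
pose S x := [set sval q x | q in A].
have lbS x z : S x z -> - p (- x) <= z.
  move=> [[q [sq qp]] _ /= <-]; apply: le_trans (sublinear_oppr_ge x sq).
  by rewrite lerN2.
have Sq (q : T) x : A q -> inf (S x) <= sval q x.
  by move=> Aq; apply: ge_inf; [exists (- p (- x)) => z /lbS|exists q].
have SN x : S x !=set0 by exists (sval q0 x), q0.
suff sS : sublinear (fun x => inf (S x)) /\ forall x, inf (S x) <= p x.
  exists (exist (fun q => sublinear q /\ forall x, q x <= p x) _ sS) => q Aq.
  by apply/asboolP => x /=; exact: Sq.
split; last by move=> x; apply: le_trans (Sq q0 x Aq0) _; case: (svalP q0).
split=> [x y|t x].
  rewrite -lerBlDr; apply: lb_le_inf => // _ [q1 Aq1 <-].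
  rewrite lerBlDr -lerBlDl; apply: lb_le_inf => // _ [q2 Aq2 <-].
  rewrite lerBlDl; have [/asboolP q12|/asboolP q21] := Atot _ _ Aq1 Aq2.
    apply: le_trans (Sq q2 _ Aq2) _; apply: le_trans ((svalP q2).1.1 _ _) _.
    by rewrite lerD2r.
  apply: le_trans (Sq q1 _ Aq1) _; apply: le_trans ((svalP q1).1.1 _ _) _.
  by rewrite lerD2l.
rewrite le_eqVlt => /predU1P[<-|t_gt0].
  apply: le_trans (Sq q0 _ Aq0) _.
  apply: le_trans ((svalP q0).1.2 _ _ _) _ => //.
  by rewrite !mul0r.
rewrite -ler_pdivrMl//; apply: lb_le_inf => // _ [q Aq <-].
rewrite ler_pdivrMl//; apply: le_trans (Sq q _ Aq) _.
by apply: (svalP q).1.2; exact: ltW.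
Qed.

(** Minimal sublinear functionals are additive by [sublinear_directional]; to
    reach the prescribed value at [v] it suffices to descend along [v] first. *)
Lemma real_hahn_banach p v : sublinear p ->
  exists a : V -> R, [/\ forall x y, a (x + y) = a x + a y,
    forall t x, a (ofR t *: x) = t * a x, forall x, a x <= p x & a v = p v].
Proof.
move=> sp; have [p' [sp' p'p p'v]] := sublinear_directional v sp.
have [q [sq qp' qmin]] := minimal_sublinear sp'.
have qD x y : q (x + y) = q x + q y.
  apply/eqP; rewrite eq_le sq.1/= -lerBrDr.
  have [q' [sq' q'q q'y]] := sublinear_directional y sq.
  by rewrite -(qmin q' sq' q'q) in q'y * => //; rewrite {1}(qmin q' sq' q'q).
have qN x : q (- x) = - q x.
  by apply/eqP; rewrite -addr_eq0 -qD addNr sublinear0.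
exists q; split=> //.
- move=> t x; have [t0|t0] := leP 0 t; first exact: sublinearZ.
  apply: oppr_inj; rewrite -qN -scaleNr -of_realN sublinearZ// ?mulNr//.
  by rewrite oppr_ge0 ltW.
- by move=> x; exact: le_trans (qp' x) (p'p x).
- apply/eqP; rewrite eq_le (le_trans (qp' v) (p'p v))/= -lerN2 -qN.
  apply: le_trans (qp' _) _; apply: le_trans (p'v _) _.
  by rewrite addNr sublinear0// sub0r.
Qed.

Lemma seminorm_sublinear p : seminorm p -> sublinear p.
Proof.
move=> [pD pZ]; split=> // t x t0; apply: le_trans (pZ _ _) _.
by rewrite rnorm_of_real ger0_norm.
Qed.

Lemma seminormN p x : seminorm p -> p (- x) = p x.
Proof.
move=> [_ pZ].
have pN y : p (- y) <= p y.
  by have := pZ (-1) y; rewrite scaleN1r rnormN rnorm1 mul1r.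
by apply/eqP; rewrite eq_le pN -{1}[x]opprK pN.
Qed.

Lemma seminorm_ge0 p x : seminorm p -> 0 <= p x.
Proof.
move=> sp; have := sp.1 x (- x).
rewrite subrr seminormN// (sublinear0 (seminorm_sublinear sp)) -mulr2n.
by rewrite pmulrn_lge0.
Qed.

End Sublinear.
End HahnBanach.

(** Over complex scalars the functional is recovered from its real part [a] as
    [a x - i a (i x)]; multiplying by a unimodular scalar makes its value real,
    so the bound on [a] bounds the modulus. *)
Lemma hahn_banach (R : realType) (k : scalar_kind) (V : lmodType (scalars R k))
    (p : V -> R) (v : V) : seminorm p ->
  exists a : V -> (scalars R k)^o, [/\ linear a, forall x, rnorm (a x) <= p x &
    a v = of_real k (p v)].
Proof.
move=> pS; have [a [aD aZ ap av]] := real_hahn_banach v (seminorm_sublinear pS).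
have aN x : a (- x) = - a x.
  apply/eqP; rewrite -addr_eq0 -aD addNr -(scale0r 0) -(of_real0 R k).
  by rewrite aZ mul0r.
case: k V p v pS a aD aZ ap av aN => V p v pS a aD aZ ap av aN.
  exists a; split=> // [t x y|x]; first by rewrite aD aZ.
  rewrite /rnorm/= ler_norml ap andbT lerNl -aN.
  by apply: le_trans (ap _) _; rewrite seminormN.
pose A x : (scalars R ComplexScalars)^o :=
  Complex (a x) (- a (Complex (0 : R) 1 *: x)).
have Cdec (z : R[i]) : z = Complex (complex.Re z) 0 +
    Complex (complex.Im z) 0 * Complex 0 1.
  case: z => b c; apply/eqP; rewrite eq_complex/=.
  by rewrite !(mul0r,mulr0,mul1r,mulr1,sub0r,addr0,add0r) oppr0 ?addr0 !eqxx.
have aC (b c : R) x : a (Complex b c *: x) =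
    b * a x + c * a (Complex (0 : R) 1 *: x).
  rewrite [Complex b c]Cdec/= scalerDl -scalerA aD.
  by rewrite -[Complex b 0]/(of_real ComplexScalars b)
    -[Complex c 0]/(of_real ComplexScalars c) !aZ.
have Alin : linear A.
  move=> [b c] x y; rewrite /A scalerDr !aD scalerA.
  have -> : Complex 0 1 * Complex b c = Complex (- c) b.
    apply/eqP; rewrite eq_complex/=.
    by rewrite !(mul0r,mulr0,mul1r,mulr1,sub0r,addr0,add0r) !eqxx.
  rewrite (aC b) (aC (- c)); set r := a x; set s := a (Complex 0 1 *: x).
  set r' := a y; set s' := a (Complex 0 1 *: y).
  rewrite -[RHS]/(Complex (b * r - c * - s + r') (b * - s + c * r - s')).
  by congr Complex; ring.
have Anorm x : rnorm (A x) <= p x.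
  have [->|Ax0] := eqVneq (A x) 0.
    by rewrite rnorm0 seminorm_ge0.
  have nA0 : `|A x| != 0 by rewrite normr_eq0.
  pose c : R[i] := `|A x| / A x.
  have c1 : `|c| = 1 by rewrite normrM normr_id normfV mulfV.
  have AcE : A (c *: x) = `|A x|.
    have := Alin c x 0; rewrite addr0 => ->.
    have -> : A 0 = 0.
      rewrite /A scaler0 (sublinear0 (q := a)) ?oppr0//.
      by split=> [y z|t y _]; rewrite ?aD ?aZ.
    by rewrite addr0 -[LHS]/(c * A x) /c divfK.
  have c1' : rnorm (c : (scalars R ComplexScalars)^o) = 1.
    exact: (congr1 (@complex.Re R) c1).
  have := pS.2 c x; rewrite c1' mul1r; apply: le_trans.
  by rewrite /rnorm -AcE; exact: ap.
exists A; split=> //; apply/eqP; rewrite eq_complex/= av eqxx/=.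
have : complex.Re `|A v : R[i]| <= p v := Anorm v.
rewrite /A normc_def av /=; set s := a _.
have [->|s0] := eqVneq s 0; first by rewrite oppr0.
rewrite -{2}[p v]ger0_norm ?seminorm_ge0// -sqrtr_sqr ler_sqrt ?sqr_ge0//.
by rewrite gerDl sqrrN leNgt lt_def sqr_ge0 sqrf_eq0 s0.
Qed.

(** * Operators, and the functionals provided by the Hahn-Banach theorem *)

Section Operators.
Context (R : realType) (k : scalar_kind).
Local Notation K := (scalars R k).
Local Notation ofR := (@of_real R k).
Implicit Types X Y Z : normedModType K.

Lemma rnorm_le1 X (x : X) : unit_ball X x <-> rnorm x <= 1.
Proof. by rewrite -(ler_of_real k) rnormE of_real1. Qed.

Lemma ler_rnormB X (x y : X) : rnorm (x - y) <= rnorm x + rnorm y.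
Proof. by rewrite -(rnormN y); exact: rnormD. Qed.

Lemma rnorm_distC X (x y : X) : rnorm (x - y) = rnorm (y - x).
Proof. by rewrite -rnormN opprB. Qed.

Lemma rnorm_triangle X (z x y : X) :
  rnorm (x - y) <= rnorm (x - z) + rnorm (z - y).
Proof. by rewrite -[x - y](subrKA z); exact: rnormD. Qed.

Lemma rnorm_sub_ge X (x y : X) : rnorm x - rnorm y <= rnorm (x - y).
Proof. by rewrite lerBlDr; have := rnormD (x - y) y; rewrite subrK. Qed.

Lemma rnormM (a b : K) :
  rnorm (a * b : K^o) = rnorm (a : K^o) * rnorm (b : K^o).
Proof. exact: (rnormZ a (b : K^o)). Qed.

Lemma rnorm_sum X n (F : 'I_n -> X) :
  rnorm (\sum_(i < n) F i) <= \sum_(i < n) rnorm (F i).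
Proof.
elim: n F => [|n IH] F; first by rewrite !big_ord0 rnorm0.
rewrite !big_ord_recr/=; apply: le_trans (rnormD _ _) _.
by rewrite lerD2r; exact: IH.
Qed.

Lemma ler_rnorm_operator X Y (T : operator X Y) x :
  rnorm (T x) <= rnorm T * rnorm x.
Proof. by rewrite -(ler_of_real k) of_realM !rnormE ler_operator_norm. Qed.

Lemma rnorm_operator_le X Y (T : operator X Y) (M : R) : 0 <= M ->
  (forall x, rnorm (T x) <= M * rnorm x) -> rnorm T <= M.
Proof.
move=> M0 TM; rewrite -(ler_of_real k) rnormE.
apply: operator_norm_le; last by rewrite -(of_real0 R k) ler_of_real.
by move=> x; rewrite -!rnormE -of_realM ler_of_real.
Qed.

Lemma ler_rnorm_operator_unit X Y (T : operator X Y) x : rnorm x <= 1 ->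
  rnorm (T x) <= rnorm T.
Proof.
move=> x1; apply: le_trans (ler_rnorm_operator T x) _.
by rewrite ler_piMr// rnorm_ge0.
Qed.

Lemma rnorm_operator_unit_le X Y (T : operator X Y) (M : R) :
  (forall x, rnorm x <= 1 -> rnorm (T x) <= M) -> rnorm T <= M.
Proof.
move=> TM; have M0 : 0 <= M.
  by apply: le_trans (TM 0 _); rewrite ?rnorm_ge0// rnorm0 ler01.
apply: rnorm_operator_le => // x; have [->|x0] := eqVneq x 0.
  by rewrite linear0 !rnorm0 mulr0.
have nx0 : rnorm x != 0 by apply: contra x0 => /eqP/rnorm_eq0/eqP.
have nx : 0 < rnorm x by rewrite lt_def nx0 rnorm_ge0.
have := TM (ofR (rnorm x)^-1 *: x); rewrite linearZ !rnormZ rnorm_of_real.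
rewrite ger0_norm ?invr_ge0 ?rnorm_ge0// mulVf// lexx => /(_ isT).
by rewrite mulrC ler_pdivrMr.
Qed.

Lemma operator_ex X Y (f : X -> Y) (M : R) : linear f -> 0 <= M ->
  (forall x, rnorm (f x) <= M * rnorm x) ->
  exists T : operator X Y, (T : X -> Y) = f /\ rnorm T <= M.
Proof.
move=> lf M0 fM.
have fP : f \in @bounded_operator R k X Y.
  apply: (@bounded_operatorP R k X Y f (ofR M)) => //.
    by rewrite -(of_real0 R k) ler_of_real.
  by move=> x; rewrite -!rnormE -of_realM ler_of_real.
by exists (Operator fP); split=> //; exact: rnorm_operator_le.
Qed.

Lemma operatorB X Y (T : operator X Y) x y : T (x - y) = T x - T y.
Proof. exact: linearB. Qed.

Lemma operatorZ X Y (T : operator X Y) (a : K) x : T (a *: x) = a *: T x.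
Proof. exact: linearZ. Qed.

Lemma sub_operatorE X Y (S T : operator X Y) x : (S - T) x = S x - T x.
Proof. by []. Qed.

Lemma scale_operatorE X Y (T : operator X Y) (a : K) x : (a *: T) x = a *: T x.
Proof. by []. Qed.

Lemma embeddingE X (x : X) (f : dual X) : canonical_embedding x f = f x.
Proof. by []. Qed.

Lemma adjointE X Y (T : operator X Y) (g : dual Y) x : adjoint T g x = g (T x).
Proof. by []. Qed.

Lemma norming_functional X (x : X) :
  exists f : dual X, rnorm f <= 1 /\ rnorm (f x) = rnorm x.
Proof.
have nS : seminorm (@rnorm R k X).
  by split=> [y z|a y]; [exact: rnormD|rewrite rnormZ].
have [a [al an ax]] := hahn_banach x nS.
have [|f [fE f1]] := @operator_ex X K^o a 1 al ler01.
  by move=> y; rewrite mul1r.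
by exists f; split=> //; rewrite fE ax rnorm_of_real ger0_norm// rnorm_ge0.
Qed.

Lemma rnorm_embedding X (x : X) : rnorm (canonical_embedding x) = rnorm x.
Proof.
apply/eqP; rewrite eq_le; apply/andP; split.
  apply: rnorm_operator_le (rnorm_ge0 _) _ => f.
  by rewrite embeddingE mulrC ler_rnorm_operator.
have [f [f1 <-]] := norming_functional x.
by rewrite -[f x]/(canonical_embedding x f) ler_rnorm_operator_unit.
Qed.

Lemma embeddingB X (x y : X) :
  canonical_embedding (x - y) = canonical_embedding x - canonical_embedding y.
Proof. by apply/val_inj/funext => f /=; rewrite linearB. Qed.

Definition subspace X (E : set X) : Prop :=
  E 0 /\ forall (a : K) x y, E x -> E y -> E (a *: x + y).

(** The distance to a subspace is a seminorm vanishing on the subspace, hence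
    so does the functional extending it from [x]. *)
Lemma annihilating_functional X (E : set X) (x : X) (d : R) : subspace E ->
  (forall e, E e -> d <= rnorm (x - e)) ->
  exists f : dual X, [/\ rnorm f <= 1, forall e, E e -> f e = 0 &
    d <= rnorm (f x)].
Proof.
move=> [E0 EL] xE; pose S y := [set rnorm (y - e) | e in E].
pose p y := inf (S y).
have lbS y : has_lbound (S y) by exists 0 => _ [e _ <-]; exact: rnorm_ge0.
have SN y : S y !=set0 by exists (rnorm (y - 0)), 0.
have pS y e : E e -> p y <= rnorm (y - e).
  by move=> Ee; apply: ge_inf => //; exists e.
have sp : seminorm p.
  split=> [y z|a y].
    rewrite -lerBlDr; apply: lb_le_inf => // _ [e1 E1 <-].
    rewrite lerBlDr -lerBlDl; apply: lb_le_inf => // _ [e2 E2 <-].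
    rewrite lerBlDl; apply: le_trans (pS _ (1 *: e1 + e2) (EL _ _ _ E1 E2)) _.
    by rewrite scale1r opprD addrACA; exact: rnormD.
  have [->|a0] := eqVneq a 0.
    apply: le_trans (pS _ 0 E0) _.
    by rewrite scale0r subr0 !rnorm0 mul0r.
  have na0 : 0 < rnorm (a : K^o).
    rewrite lt_def rnorm_ge0 andbT; apply: contra a0 => /eqP/rnorm_eq0 ->//.
  rewrite -ler_pdivrMl//; apply: lb_le_inf => // _ [e Ee <-].
  rewrite ler_pdivrMl//.
  apply: le_trans (pS _ (a *: e + 0) (EL _ _ _ Ee E0)) _.
  by rewrite addr0 -scalerBr rnormZ.
have [a [al ap ax]] := hahn_banach x sp.
have p_le y : p y <= rnorm y by have := pS y 0 E0; rewrite subr0.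
have [|f [fE f1]] := @operator_ex X K^o a 1 al ler01.
  by move=> y; rewrite mul1r; exact: le_trans (p_le y).
exists f; split=> //.
- move=> e Ee; apply: rnorm_eq0; apply/eqP; rewrite eq_le rnorm_ge0 andbT fE.
  apply: le_trans (ap e) _; apply: le_trans (pS e e Ee) _.
  by rewrite subrr rnorm0.
- rewrite fE ax rnorm_of_real ger0_norm ?seminorm_ge0//.
  by apply: lb_le_inf => // _ [e Ee <-]; exact: xE.
Qed.

(** On scalar vectors, [p w = inf_x (|x| + N |w - (f_i x)_i|)] is a seminorm
    with [p ((f_i x)_i) <= |x|]; so a functional supporting [p] at
    [((1 - r) u f_i)_i] yields, composed with [x |-> (f_i x)_i], a combination
    of the [f_i] of norm at most 1. Evaluating [u] at this combination shows
    that [p] is less than 1 at that vector. *)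
Lemma goldstine X (u : dual (dual X)) n (f : 'I_n -> dual X) (e : R) :
  rnorm u <= 1 -> 0 < e ->
  exists x, rnorm x <= 1 /\ forall i, rnorm (u (f i) - f i x) < e.
Proof.
move=> u1 e0.
pose M := 1 + \sum_i rnorm (f i).
have M0 : 0 < M by rewrite ltr_pwDl// sumr_ge0// => i _; exact: rnorm_ge0.
have fM i : rnorm (f i) <= M.
  rewrite /M (bigD1 i)//= addrCA lerDl addr_ge0// sumr_ge0// => j _.
  exact: rnorm_ge0.
(* [N] makes errors of size [e / 2] cost 1; replacing [u] by [(1 - r) u]
   changes its values on the [f_i] by at most [e / 2]. *)
pose N := 2 / e; have N0 : 0 < N by rewrite divr_gt0.
pose r := Num.min (1 / 2) (e / 2 / M).
have r0 : 0 < r by rewrite lt_min !divr_gt0.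
have r2 : r <= 1 / 2 by rewrite ge_min lexx.
have r1 : 0 < 1 - r by lra.
have rM : r * M <= e / 2 by rewrite -ler_pdivlMr// ge_min lexx orbT.
pose D (w : 'rV[K]_n) x := rnorm x + N * \sum_i rnorm (w 0 i - f i x : K^o).
have sum0 w x : 0 <= N * \sum_i rnorm (w 0 i - f i x : K^o).
  by apply: mulr_ge0 (ltW N0) (sumr_ge0 _ _) => i _; exact: rnorm_ge0.
have D0 w x : 0 <= D w x by rewrite addr_ge0 ?rnorm_ge0.
pose S w := [set D w x | x in [set: X]].
pose p w := inf (S w).
have lbS w : has_lbound (S w) by exists 0 => _ [x _ <-].
have SN w : S w !=set0 by exists (D w 0), 0.
have pS w x : p w <= D w x by apply: ge_inf => //; exists x.
have sp : seminorm p.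
  split=> [y z|a y].
    rewrite -lerBlDr; apply: lb_le_inf => // _ [x1 _ <-].
    rewrite lerBlDr -lerBlDl; apply: lb_le_inf => // _ [x2 _ <-].
    rewrite lerBlDl; apply: le_trans (pS _ (x1 + x2)) _.
    rewrite /D addrACA -mulrDr; apply: lerD; first exact: rnormD.
    rewrite ler_pM2l// -big_split/= ler_sum// => i _.
    by rewrite !mxE linearD opprD addrACA; exact: rnormD.
  have [->|a0] := eqVneq a 0.
    apply: le_trans (pS _ 0) _; rewrite /D !rnorm0 mul0r add0r.
    rewrite big1 ?mulr0// => i _.
    by rewrite scale0r mxE linear0 subrr rnorm0.
  have na0 : 0 < rnorm (a : K^o).
    rewrite lt_def rnorm_ge0 andbT; apply: contra a0 => /eqP/rnorm_eq0 ->//.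
  rewrite -ler_pdivrMl//; apply: lb_le_inf => // _ [x _ <-].
  rewrite ler_pdivrMl//; apply: le_trans (pS _ (a *: x)) _.
  rewrite /D mulrDr rnormZ lerD2l mulrCA ler_pM2l// mulr_sumr ler_sum// => i _.
  by rewrite mxE linearZ -mulrBr rnormM.
pose v : 'rV[K]_n := \row_i (ofR (1 - r) * u (f i)).
have [a [al ap av]] := hahn_banach v sp.
have pv : p v < 1.
  pose c i : K := a (delta_mx 0 i).
  have aE w : a w = \sum_i w 0 i * c i.
    pose al' : {linear 'rV[K]_n -> K^o} :=
      HB.pack a (GRing.isLinear.Build _ _ _ _ a al).
    rewrite -[a w]/(al' w) {1}(row_sum_delta w) linear_sum.
    by apply: eq_bigr => i _; rewrite linearZ.
  pose g : dual X := \sum_i c i *: f i.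
  have gE x : g x = \sum_i c i * f i x.
    rewrite -[g x]/(canonical_embedding x g) linear_sum.
    by apply: eq_bigr => i _; rewrite linearZ.
  have g1 : rnorm g <= 1.
    apply: rnorm_operator_le => // x; rewrite mul1r.
    pose w : 'rV[K]_n := \row_i f i x.
    have -> : g x = a w.
      by rewrite gE aE; apply: eq_bigr => i _; rewrite mxE mulrC.
    apply: le_trans (ap w) _; apply: le_trans (pS w x) _.
    rewrite /D big1 ?mulr0 ?addr0// => i _.
    by rewrite mxE subrr rnorm0.
  have avE : a v = ofR (1 - r) * u g.
    rewrite linear_sum mulr_sumr aE; apply: eq_bigr => i _.
    by rewrite linearZ mxE -mulrA; congr (_ * _); rewrite mulrC.
  have : rnorm (a v) <= 1 - r.
    rewrite avE rnormM rnorm_of_real gtr0_norm// ger_pMr//.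
    apply: le_trans (ler_rnorm_operator u g) _.
    by rewrite mulr_ile1 ?rnorm_ge0.
  by rewrite av rnorm_of_real ger0_norm ?seminorm_ge0//; lra.
have [_ [x _ <-] Dx] : exists2 z, S v z & z < 1.
  by apply: inf_lt => //; split=> //; exact: lbS.
have sx : N * \sum_i rnorm (v 0 i - f i x : K^o) < 1.
  by apply: le_lt_trans Dx; rewrite lerDr rnorm_ge0.
exists x; split.
  by apply/ltW; apply: le_lt_trans Dx; rewrite lerDl.
move=> i; have -> : u (f i) - f i x = ofR r * u (f i) + (v 0 i - f i x).
  rewrite mxE addrA -mulrDl -of_realD subrKC; congr (_ - _).
  by rewrite of_real1 mul1r.
apply: le_lt_trans (rnormD _ _) _.
have vx : rnorm (v 0 i - f i x : K^o) < e / 2.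
  have -> : e / 2 = N^-1 by rewrite invf_div.
  rewrite -[ltRHS]mulr1 ltr_pdivlMl//; apply: le_lt_trans sx.
  rewrite ler_pM2l// (bigD1 i)//= lerDl sumr_ge0// => j _.
  exact: rnorm_ge0.
have : rnorm (ofR r * u (f i) : K^o) <= e / 2.
  rewrite rnormM rnorm_of_real gtr0_norm//; apply: le_trans rM.
  rewrite ler_pM2l//; apply: le_trans (fM i).
  apply: le_trans (ler_rnorm_operator u _) _.
  by rewrite ler_piMl// rnorm_ge0.
lra.
Qed.

End Operators.

(** * Limits along ultrafilters, and the weak and weak-star topologies *)

Section Ultrafilters.
Context (R : realType) (k : scalar_kind).
Local Notation K := (scalars R k).
Local Notation ofR := (@of_real R k).
Implicit Types X Y Z : normedModType K.

Lemma ltr_of_real (a b : R) : (ofR a < ofR b) = (a < b).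
Proof. by rewrite !lt_neqAle ler_of_real (can_eq (@of_realK R k)). Qed.

Lemma cvg_rnormP X I (F : set_system I) (h : I -> X) (l : X) : Filter F ->
  h @ F --> l <-> forall e : R, 0 < e -> F [set i | rnorm (l - h i) < e].
Proof.
move=> FF; split=> [/cvgrPdist_lt hl e e0|hl].
  have := hl _ (of_real_gt0 k e0); apply: filterS => i.
  by rewrite -rnormE ltr_of_real.
apply/cvgrPdist_lt => _ /gt0_of_real[e e0 ->]; have := hl e e0.
by apply: filterS => i /=; rewrite -rnormE ltr_of_real.
Qed.

Lemma cvg_rnorm_le X I (F : set_system I) (h : I -> X) (l y : X) (c : R) :
  ProperFilter F -> h @ F --> l -> F [set i | rnorm (h i - y) <= c] ->
  rnorm (l - y) <= c.
Proof.
move=> FF /cvg_rnormP hl hc; apply/ler_addgt0Pr => e e0.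
have [i [/= hi li]] := filter_ex (filterI hc (hl e e0)).
apply: le_trans (rnorm_triangle (h i) _ _) _.
by rewrite addrC lerD// ltW.
Qed.

Lemma cvg_rnorm_uniq X I (F : set_system I) (h : I -> X) (l l' : X) :
  ProperFilter F -> h @ F --> l -> h @ F --> l' -> l = l'.
Proof.
move=> FF hl hl'; apply/eqP; rewrite -subr_eq0; apply/eqP/rnorm_eq0/eqP.
rewrite eq_le rnorm_ge0 andbT; apply/ler_addgt0Pr => e e0; rewrite add0r.
apply: cvg_rnorm_le hl _; move/cvg_rnormP: hl' => /(_ _ e0).
by apply: filterS => i /= /ltW; rewrite rnorm_distC.
Qed.

Lemma cvg_scalar_uniq I (F : set_system I) (h : I -> K^o) (l l' : K^o) :
  ProperFilter F -> h @ F --> l -> h @ F --> l' -> l = l'.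
Proof. exact: (@cvg_rnorm_uniq K^o). Qed.

End Ultrafilters.

Lemma complex_rnorm_le (R : realType) (c d : R) :
  rnorm (Complex c d : (scalars R ComplexScalars)^o) <= `|c| + `|d|.
Proof.
have -> : Complex c d =
    of_real ComplexScalars c + of_real ComplexScalars d * Complex 0 1.
  apply/eqP; rewrite eq_complex/= !(mul0r,mulr0,mulr1,sub0r,addr0,add0r).
  by rewrite oppr0 ?addr0 !eqxx.
apply: le_trans (rnormD _ _) _; rewrite rnormM !rnorm_of_real lerD2l.
by rewrite ler_piMr//= expr0n/= add0r expr1n sqrtr1.
Qed.

Section UltrafilterLimits.
Context (R : realType) (k : scalar_kind).
Local Notation K := (scalars R k).
Implicit Types X Y Z : normedModType K.

Lemma ultra_compact_cvg (T : topologicalType) I (V : set_system I)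
    (h : I -> T) (A : set T) : UltraFilter V -> compact A ->
  V (h @^-1` A) -> exists2 l, A l & h @ V --> l.
Proof.
move=> VU cA VA; have [l [Al hl]] := cA (h @ V) _ VA.
exists l => // B nB; have [//|VB] := in_ultra_setVsetC (h @^-1` B) VU.
by have [y [hy]] := hl (~` B) B VB nB.
Qed.

(** Scalars have compact bounded sets; complex ones are treated through their
    real and imaginary parts. *)
Lemma ultra_bounded_cvg I (V : set_system I) (h : I -> K^o) (M : R) :
  UltraFilter V -> V [set i | rnorm (h i) <= M] ->
  exists l : K^o, h @ V --> l.
Proof.
have real_case (g : I -> R) (VU : UltraFilter V) :
    V [set i | `|g i| <= M] -> exists l : R, g @ V --> l.
  move=> gM; have [|l _ gl] :=
      ultra_compact_cvg (h := g) VU (@segment_compact R (- M) M).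
    by apply: filterS gM => i /=; rewrite in_itv/= ler_norml.
  by exists l.
move=> VU; case: k h => h hM; first exact: real_case.
have [|a ha] := real_case (@complex.Re R \o h) VU.
  apply: filterS hM => i /=; apply: le_trans.
  by rewrite -lecR; exact: normc_ge_Re.
have [|b hb] := real_case (@complex.Im R \o h) VU.
  apply: filterS hM => i /=; apply: le_trans.
  case: (h i) => c d /=; rewrite -sqrtr_sqr ler_wsqrtr//.
  by rewrite lerDr sqr_ge0.
exists (Complex a b); apply/cvg_rnormP => e e0.
have e20 : 0 < e / 2 by rewrite divr_gt0.
have /cvgrPdist_lt/(_ _ e20) ha' := ha; have /cvgrPdist_lt/(_ _ e20) hb' := hb.
apply: filterS (filterI ha' hb') => i /= [ai bi].
have -> : (Complex a b : (scalars R ComplexScalars)^o) - h i =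
    Complex (a - complex.Re (h i)) (b - complex.Im (h i)).
  by case: (h i).
by apply: le_lt_trans (complex_rnorm_le _ _) _; rewrite [ltRHS]splitr ltrD.
Qed.

(** The Banach-Alaoglu theorem in the bidual, as pointwise convergence of a
    bounded family along an ultrafilter. *)
Lemma functional_limit Z I (V : set_system I) (z : I -> Z) (M : R) :
  UltraFilter V -> V [set i | rnorm (z i) <= M] ->
  exists u : dual (dual Z), rnorm u <= M /\
    forall f : dual Z, (f (z i) : K^o) @[i --> V] --> (u f : K^o).
Proof.
move=> VU zM.
have M0 : 0 <= M.
  by have [i iz] := filter_ex zM; apply: le_trans iz; exact: rnorm_ge0.
have fz (f : dual Z) : exists l : K^o, (f (z i) : K^o) @[i --> V] --> l.
  apply: (@ultra_bounded_cvg _ _ _ (rnorm f * M)); apply: filterS zM => i /=.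
  move=> zi; apply: le_trans (ler_rnorm_operator f _) _.
  by rewrite ler_wpM2l ?rnorm_ge0.
have [u uE] := choice fz.
have ul : linear u.
  move=> a f g; apply: (@cvg_scalar_uniq R k I V _ _ (a *: u f + u g) _ (uE _)).
  by apply: (cvgD _ (uE g)); apply: cvgZl_tmp; exact: uE.
have [|u' [u'E u'M]] := @operator_ex R k (dual Z) K^o u M ul M0.
  move=> f; rewrite -[u f]subr0; apply: cvg_rnorm_le (uE f) _.
  apply: filterS zM => i /= zi; rewrite subr0 mulrC.
  by apply: le_trans (ler_rnorm_operator f _) _; rewrite ler_wpM2l ?rnorm_ge0.
by exists u'; split=> // f; rewrite u'E.
Qed.

End UltrafilterLimits.

Section PointwiseTopology.
Context (S I : choiceType) (T : topologicalType) (e : S -> I -> T).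
Local Notation W :=
  (initial_topology (e : S -> prod_topology (fun _ : I => T))).

Lemma pointwise_eval_continuous i : continuous (fun s : W => e s i).
Proof.
move=> s; apply: (@continuous_comp W (prod_topology (fun _ : I => T)) T
  (e : W -> prod_topology (fun _ : I => T)) (fun g => g i)).
  exact: initial_continuous.
exact: (@proj_continuous I (fun=> T) i).
Qed.

Lemma cvg_initial (S' : choiceType) (T' : topologicalType) (f : S' -> T')
    (F : set_system S') (s : S') : Filter F ->
  f @ F --> f s -> F --> (s : initial_topology f).
Proof.
move=> FF fF A /= [_ [[B Bop <-] Bfs sBfA]].
have : F (f @^-1` B) by apply: fF; exact: open_nbhs_nbhs.
exact: filterS.
Qed.

Lemma pointwise_cvg (F : set_system S) (s : S) : Filter F ->
  (forall i, e t i @[t --> F] --> e s i) -> F --> (s : W).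
Proof.
move=> FF Fs; apply: cvg_initial; apply/cvg_sup => i.
apply: (@cvg_initial (prod_topology (fun _ : I => T)) T (fun g => g i)).
exact: (Fs i).
Qed.

End PointwiseTopology.

Section WeakStarClosure.
Context (R : realType) (k : scalar_kind).
Local Notation K := (scalars R k).
Implicit Types X Y Z : normedModType K.

Lemma weak_star_closure_ultra Z I (h : I -> dual Z) (A : set I) (u : dual Z) :
  closure (h @` A : set (weak_star Z)) u ->
  exists V : set_system I, [/\ UltraFilter V, V A &
    forall x, (h i x : K^o) @[i --> V] --> (u x : K^o)].
Proof.
move=> clu.
pose G := filter_from [set B | nbhs (u : weak_star Z) B]
  (fun B => A `&` h @^-1` B).
have GP : ProperFilter G.
  apply: filter_from_proper; last first.
    by move=> B /clu[_ [[i Ai <-] Bi]]; exists i.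
  apply: filter_from_filter; first by exists setT; exact: filterT.
  move=> B C nB nC; exists (B `&` C); first exact: filterI.
  by move=> i [Ai [Bi Ci]].
have [V [VU GV]] := ultraFilterLemma GP.
exists V; split=> //.
  by apply: GV; exists setT; [exact: filterT|move=> i []].
move=> x B nB; apply: GV.
exists ((fun g : dual Z => g x) @^-1` B) => [/=|i []//].
exact: (@pointwise_eval_continuous (dual Z) Z K^o _ x u B nB).
Qed.

Lemma weak_star_closure_limit Z I (V : set_system I) (h : I -> dual Z)
    (B : set (dual Z)) (u : dual Z) : ProperFilter V -> V (h @^-1` B) ->
  (forall x, (h i x : K^o) @[i --> V] --> (u x : K^o)) ->
  closure (B : set (weak_star Z)) u.
Proof.
move=> VP VB hu N nN.
have hV : h @ V --> (u : weak_star Z) by apply: pointwise_cvg.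
have VN : V (h @^-1` N) by exact: hV.
by have [i [Bi Ni]] := filter_ex (filterI VB VN); exists (h i).
Qed.

(** A net in the ball of [X] has a weak-star cluster point in the bidual ball,
    and the second adjoint of [T] is weak-star continuous. *)
Lemma closure_image_bidual X Y (T : operator X Y) (u : dual (dual Y)) :
  closure (@canonical_embedding R k Y @` (T @` unit_ball X) :
    set (weak_star (dual Y))) u ->
  exists v : dual (dual X), rnorm v <= 1 /\ u = adjoint (adjoint T) v.
Proof.
rewrite image_comp => /weak_star_closure_ultra[V [VU VB uV]].
have [v [v1 vV]] : exists v : dual (dual X), rnorm v <= 1 /\
    forall f : dual X, (f x : K^o) @[x --> V] --> (v f : K^o).
  by apply: functional_limit; apply: filterS VB => x /rnorm_le1.
exists v; split=> //; apply/val_inj/funext => g.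
exact: (@cvg_scalar_uniq R k _ V (fun x => g (T x)) _ _ _ (uV g)
  (vV (adjoint T g))).
Qed.

(** Goldstine's theorem, transported by [T]. *)
Lemma bidual_image_closure X Y (T : operator X Y) (v : dual (dual X)) :
  rnorm v <= 1 ->
  closure (@canonical_embedding R k Y @` (T @` unit_ball X) :
    set (weak_star (dual Y))) (adjoint (adjoint T) v).
Proof.
move=> v1; rewrite image_comp.
(* the weak-star neighborhoods of [v] given by finitely many functionals of the
   form [T^* g], traced on the ball of [X] *)
pose D := [set se : seq (dual Y) * R | 0 < se.2].
pose B (se : seq (dual Y) * R) := unit_ball X `&`
  [set x | forall g, g \in se.1 ->
    rnorm (v (adjoint T g) - g (T x) : K^o) < se.2].
have GP : ProperFilter (filter_from D B).
  apply: filter_from_proper; last first.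
    move=> [s e] /= e0.
    have [x [x1 xs]] := @goldstine R k X v (size s)
      (fun i => adjoint T (nth 0 s i)) e v1 e0.
    exists x; split; first exact/rnorm_le1.
    by move=> g /= /(nthP 0)[i si <-]; exact: (xs (Ordinal si)).
  apply: filter_from_filter; first by exists ([::], 1) => /=; exact: ltr01.
  move=> [s e] [s' e'] /= e0 e0'; exists (s ++ s', Num.min e e').
    by rewrite /D/= lt_min e0.
  move=> x [Bx /= xs]; split; split=> // g gs /=.
    by have := xs g; rewrite mem_cat gs => /(_ isT); rewrite lt_min => /andP[].
  have := xs g; rewrite mem_cat gs orbT => /(_ isT).
  by rewrite lt_min => /andP[].
apply: (@weak_star_closure_limit _ _ (filter_from D B)
  (canonical_embedding (X:=Y) \o T)).
  exists ([::], 1) => [|x [Bx _]]; first exact: ltr01.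
  by exists x.
move=> g; apply/cvg_rnormP => e e0; exists ([:: g], e) => // x [_ /= xg].
by apply: xg; rewrite inE.
Qed.

End WeakStarClosure.

(** * Weak noncompactness of a set and of the image of an operator *)

Section WeakNoncompactness.
Context (R : realType) (k : scalar_kind).
Local Notation K := (scalars R k).
Local Notation J := (@canonical_embedding R k _).
Implicit Types X Y Z : normedModType K.
Local Open Scope ereal_scope.

Lemma wk_lt_dist Z (A : set Z) (w : R) (u : dual (dual Z)) :
  wk A < w%:E -> closure (J @` A : set (weak_star (dual Z))) u ->
  exists y, (rnorm (u - J y) < w)%R.
Proof.
move=> Aw uA.
have : dist_to_space u < w%:E.
  by apply: le_lt_trans Aw; apply: ereal_sup_ubound; exists u.
by move=> /ereal_inf_lt[_ [y _ <-]]; rewrite lte_fin; exists y.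
Qed.

Lemma wk_le_dist Z (A : set Z) (w : R) :
  (forall u, closure (J @` A : set (weak_star (dual Z))) u ->
    exists y, (rnorm (u - J y) <= w)%R) -> wk A <= w%:E.
Proof.
move=> Aw; apply: ge_ereal_sup => _ [u /Aw[y uy] <-].
by apply: ge_ereal_inf; exists (rnorm (u - J y))%:E; [exists y|rewrite lee_fin].
Qed.

Lemma wk_ge0 Z (A : set Z) : A !=set0 -> 0 <= wk A.
Proof.
move=> [y Ay]; apply: (@le_trans _ _ (dist_to_space (J y))).
  by apply: le_ereal_inf_tmp => _ [z _ <-]; rewrite lee_fin rnorm_ge0.
apply: ereal_sup_ubound; exists (J y) => //.
by apply: subset_closure; exists y.
Qed.

Lemma wkS Z (A B : set Z) : A `<=` B -> wk A <= wk B.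
Proof.
move=> AB; apply: ereal_sup_le => _ [u uA <-]; exists u => //.
by apply: closureS uA; exact: image_subset.
Qed.

Lemma wk_op_ge0 X Y (T : operator X Y) : 0 <= wk_op T.
Proof.
by apply: wk_ge0; exists (T 0%R), 0%R => //; apply/rnorm_le1; rewrite rnorm0.
Qed.

Lemma wk_range_ge0 Z (z : nat -> Z) : 0 <= wk (range z).
Proof. by apply: wk_ge0; exists (z 0%N), 0%N. Qed.

(** Reduces a bound by a possibly infinite [y] to real numbers above [y]. *)
Lemma lee_mulr_limit (C : R) (x y : \bar R) : (0 < C)%R -> 0 <= y ->
  (forall w : R, y < w%:E -> x <= (C * w)%:E) -> x <= C%:E * y.
Proof.
move=> C0; case: y => [y _ xy|_ _|//]; last first.
  by rewrite gt0_muley ?lte_fin// leey.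
rewrite -EFinM; apply/lee_addgt0Pr => e e0.
have := xy (y + e / C)%R; rewrite lte_fin ltrDl divr_gt0// => /(_ isT).
by rewrite mulrDr (mulrCA C) mulfV ?gt_eqF// mulr1 EFinD.
Qed.

End WeakNoncompactness.

Section Gantmacher.
Context (R : realType) (k : scalar_kind).
Local Notation K := (scalars R k).
Local Notation J := (@canonical_embedding R k _).
Implicit Types X Y Z : normedModType K.

(** For [u] in the weak-star closure of [T^* B_{Y^*}], write [u = v o T^**] with
    [v] in the ball of the third dual; the restriction of [v] to [Y] gives the
    element [T^* y] of [X^*], which is close to [u] because [T^**] maps the ball
    close to [Y], where [v] and [y] agree. *)
Lemma wk_adjoint_le X Y (T : operator X Y) (w : R) :
  (wk_op T < w%:E)%E -> (wk_op (adjoint T) <= (2 * w)%:E)%E.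
Proof.
move=> Tw; apply: wk_le_dist => _ /closure_image_bidual[v [v1 ->]].
have vJ : linear (fun y : Y => v (J y) : K^o).
  move=> a y z; rewrite -linearP; congr (v _).
  by apply/val_inj/funext => f /=; rewrite linearP.
have [|y [yE y1]] := operator_ex vJ (@ler01 R).
  move=> y; rewrite mul1r; apply: le_trans (ler_rnorm_operator v _) _.
  by rewrite rnorm_embedding ler_piMl ?rnorm_ge0.
exists (adjoint T y); apply: rnorm_operator_unit_le => x x1.
have [z xz] := wk_lt_dist Tw (bidual_image_closure (T := T) x1).
set d := adjoint (adjoint T) x - J z.
have -> : (adjoint (adjoint (adjoint T)) v - J (adjoint T y)) x = v d - d y.
  have dE : d y = adjoint (adjoint T) x y - y z by [].
  rewrite -[LHS]/(v (adjoint (adjoint T) x) - adjoint (adjoint T) x y).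
  by rewrite linearB dE yE opprB addrA subrK.
rewrite mulr_natl mulr2n; apply: le_trans (ler_rnormB _ _) _.
apply: lerD; apply: le_trans (ler_rnorm_operator _ _) _;
  apply: le_trans _ (ltW xz).
  by rewrite ler_piMl ?rnorm_ge0.
by rewrite ler_piMr ?rnorm_ge0.
Qed.

(** A functional vanishing on [E] vanishes at [u], hence is small at any point
    near [u]; so such a point is near [E]. *)
Lemma near_subspace Z (E : set Z) I (V : set_system I) (z : I -> Z)
    (u : dual (dual Z)) (y : Z) (d : R) : ProperFilter V -> subspace E ->
  V (z @^-1` E) ->
  (forall f : dual Z, (f (z i) : K^o) @[i --> V] --> (u f : K^o)) ->
  (rnorm (u - J y) < d)%R ->
  exists2 e, E e & (rnorm (u - J e) < 2 * d)%R.
Proof.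
move=> VP sE VE zu uy.
have [[e [Ee ye]]|nE] := pselect (exists e, E e /\ (rnorm (y - e) < d)%R).
  exists e => //; apply: le_lt_trans (rnorm_triangle (J y) _ _) _.
  by rewrite -embeddingB rnorm_embedding mulr_natl mulr2n ltrD.
have [|f [f1 fE fy]] := @annihilating_functional R k Z E y d sE.
  by move=> e Ee; rewrite leNgt; apply/negP => ye; apply: nE; exists e.
have uf : u f = 0%R.
  apply: (@cvg_scalar_uniq R k _ V _ _ 0%R _ (zu f)); apply/cvg_rnormP => r r0.
  by apply: filterS VE => i /fE /= ->; rewrite subrr rnorm0.
have := ler_rnorm_operator_unit (u - J y) f1.
rewrite sub_operatorE uf sub0r rnormN embeddingE leNgt.
by rewrite (lt_le_trans uy fy).
Qed.

End Gantmacher.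

(** * A quantitative Eberlein-Smulian theorem *)

Section Sequences.
Context (R : realType) (k : scalar_kind).
Local Notation K := (scalars R k).
Local Notation J := (@canonical_embedding R k _).
Implicit Types X Y Z : normedModType K.

Lemma increasing_ge_id (s : nat -> nat) :
  {homo s : m n / (m < n)%N} -> forall n, (n <= s n)%N.
Proof.
by move=> sinc; elim=> // n IH; apply: leq_ltn_trans IH _; exact: sinc.
Qed.

Lemma subsequence_ex (P : nat -> nat -> Prop) :
  (forall n N, exists2 m, (N <= m)%N & P n m) ->
  exists s, {homo s : m n / (m < n)%N} /\ forall n, P n (s n).
Proof.
move=> PN; have /choice[c cP] : forall nN : nat * nat,
    exists m, (nN.2 <= m)%N /\ P nN.1 m.
  by move=> [n N]; have [m] := PN n N; exists m.
pose s := fix s n := if n is n'.+1 then c (n, (s n').+1) else c (0%N, 0%N).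
exists s; split; last first.
  by case=> [|n]; [exact: (cP (0%N, 0%N)).2|exact: (cP (n.+1, (s n).+1)).2].
by apply: homo_ltn; [exact: ltn_trans|move=> n; exact: (cP (n.+1, (s n).+1)).1].
Qed.

Lemma limn_esup_le (u : nat -> \bar R) (c : \bar R) :
  (forall s, {homo s : m n / (m < n)%N} -> ~ forall n, (c < u (s n))%E) ->
  (limn_esup u <= c)%E.
Proof.
move=> uc; have [[N uN]|nN] :=
    pselect (exists N, forall n, (N <= n)%N -> (u n <= c)%E).
  apply: ge_ereal_inf; exists (ereal_sup (u @` [set n | (N <= n)%N])).
    by exists [set n | (N <= n)%N] => //; exists N.
  by apply: ge_ereal_sup => _ [n /= /uN un <-].
have [n N|s [sinc sP]] := @subsequence_ex (fun _ n => (c < u n)%E); last first.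
  by have := uc s sinc sP.
apply: contrapT => nm; apply: nN; exists N => m Nm.
by rewrite leNgt; apply/negP => cm; apply: nm; exists m.
Qed.

Lemma tail_osc_le (a : nat -> nat -> \bar R) (c : \bar R) n0 :
  (forall i j, (n0 <= i)%N -> (n0 <= j)%N -> (a i j <= c)%E) ->
  (tail_osc a <= c)%E.
Proof.
move=> ac; apply: ge_ereal_inf; eexists; first by exists n0.
by apply: ge_ereal_sup => _ [i /= ni [j /= nj <-]]; exact: ac.
Qed.

Lemma tail_osc_lt (a : nat -> nat -> \bar R) (c : \bar R) :
  (tail_osc a < c)%E -> exists n0, forall i j,
    (n0 <= i)%N -> (n0 <= j)%N -> (a i j < c)%E.
Proof.
move=> /ereal_inf_lt[_ [n0 _ <-]] ac; exists n0 => i j ni nj.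
by apply: le_lt_trans ac; apply: ereal_sup_ubound; exists i => //; exists j.
Qed.

Lemma delta_le Z (z : nat -> Z) (c : R) :
  (forall f : dual Z, rnorm f <= 1 -> exists n0, forall i j,
    (n0 <= i)%N -> (n0 <= j)%N -> rnorm (f (z i - z j) : K^o) <= c) ->
  (delta z <= c%:E)%E.
Proof.
move=> zc; apply: ge_ereal_sup => _ [F [/finite_seqP[G ->] FB] <-].
have [n0 n0P] : exists n0, forall f, f \in G -> forall i j,
    (n0 <= i)%N -> (n0 <= j)%N -> rnorm (f (z i - z j) : K^o) <= c.
  have /choice[N NP] : forall f : dual Z, exists n, f \in G -> forall i j,
      (n <= i)%N -> (n <= j)%N -> rnorm (f (z i - z j) : K^o) <= c.
    move=> f; have [fG|nfG] := pselect (f \in G); last by exists 0%N.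
    have [n0 n0P] := zc f ((rnorm_le1 f).1 (FB f fG)).
    by exists n0.
  exists (\max_(f <- G) N f)%N => f fG i j mi mj.
  have fm : (N f <= \max_(f <- G) N f)%N by exact: leq_bigmax_seq.
  by apply: NP => //; exact: leq_trans fm _.
apply: (@tail_osc_le _ _ n0) => i j ni nj.
by apply: ge_ereal_sup => _ [f fG <-]; rewrite lee_fin; exact: n0P.
Qed.

Lemma delta_lt Z (z : nat -> Z) (c : R) (f : dual Z) :
  (delta z < c%:E)%E -> rnorm f <= 1 -> exists n0, forall i j,
    (n0 <= i)%N -> (n0 <= j)%N -> rnorm (f (z i - z j) : K^o) < c.
Proof.
move=> zc f1; have : (tail_osc (fun i j =>
    ereal_sup [set (rnorm (g (z i - z j) : K^o))%:E | g in [set f]]) < c%:E)%E.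
  apply: le_lt_trans zc; apply: ereal_sup_ubound; exists [set f] => //.
  by split=> // g ->; exact/rnorm_le1.
move=> /tail_osc_lt[n0 n0P]; exists n0 => i j ni nj.
by have := n0P i j ni nj; rewrite image_set1 ereal_sup1 lte_fin.
Qed.

Lemma delta_ge0 Z (z : nat -> Z) : (0 <= delta z)%E.
Proof.
pose F := [set (0%R : dual Z)].
pose a i j := ereal_sup [set (rnorm (g (z i - z j) : K^o))%:E | g in F].
have : (tail_osc a <= delta z)%E.
  apply: ereal_sup_ubound; exists F => //.
  split; first exact: finite_set1.
  by move=> g ->; apply/rnorm_le1; rewrite rnorm0 ler01.
apply: le_trans; apply: le_ereal_inf_tmp => _ [n0 _ <-].
apply: (@le_trans _ _ (a n0 n0)).
  by rewrite /a image_set1 ereal_sup1 lee_fin rnorm_ge0.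
by apply: ereal_sup_ubound; exists n0 => //=; exists n0 => //=.
Qed.

Lemma free_ultrafilter : exists U : set_system nat, UltraFilter U /\ \oo `<=` U.
Proof. exact: ultraFilterLemma. Qed.

End Sequences.

Lemma scalars_dense (R : realType) (k : scalar_kind) :
  exists q : nat -> scalars R k, forall a (e : R), 0 < e ->
    exists n, rnorm (a - q n : (scalars R k)^o) < e.
Proof.
have ratd (x e : R) : 0 < e -> exists r : rat, `|x - ratr r| < e.
  move=> e0; have [|r] := @rat_in_itvoo R (x - e) (x + e); first by lra.
  rewrite in_itv/= => /andP[r1 r2].
  by exists r; rewrite ltr_norml; apply/andP; split; lra.
case: k.
  exists (fun n => if @unpickle rat n is Some r then ratr r else 0) => a e e0.
  have [r ar] := ratd a e e0; exists (pickle r).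
  by rewrite pickleK.
pose c (r : rat * rat) : R[i] := Complex (ratr r.1) (ratr r.2).
exists (fun n => if @unpickle (rat * rat)%type n is Some r then c r else 0).
move=> [a b] e e0; have e20 : 0 < e / 2 by rewrite divr_gt0.
have [r ar] := ratd a _ e20; have [s bs] := ratd b _ e20.
exists (pickle (r, s)); rewrite pickleK.
rewrite [ltRHS]splitr; apply: le_lt_trans (ltrD ar bs).
exact: complex_rnorm_le.
Qed.

Section Eberlein.
Context (R : realType) (k : scalar_kind).
Local Notation K := (scalars R k).
Local Notation J := (@canonical_embedding R k _).
Implicit Types X Y Z : normedModType K.

Definition span Z (z : nat -> Z) : set Z :=
  [set y | exists n (c : nat -> K), y = \sum_(i < n) c i *: z i].

Lemma span_subspace Z (z : nat -> Z) : subspace (span z).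
Proof.
split=> [|a _ _ [n [c ->]] [m [d ->]]].
  by exists 0%N, (fun=> 0); rewrite big_ord0.
have widen p q (b : nat -> K) : (p <= q)%N ->
    \sum_(i < p) b i *: z i =
    \sum_(i < q) (if (i < p)%N then b i else 0) *: z i.
  move=> pq; rewrite (big_ord_widen q (fun i => b i *: z i) pq) big_mkcond/=.
  by apply: eq_bigr => i _; case: ifP; rewrite // scale0r.
rewrite (widen _ _ c (leq_maxl n m)) (widen _ _ d (leq_maxr n m)).
exists (maxn n m), (fun i => a * (if (i < n)%N then c i else 0) +
  (if (i < m)%N then d i else 0)).
rewrite scaler_sumr -big_split/=; apply: eq_bigr => i _.
by rewrite scalerDl scalerA.
Qed.

Lemma span_mem Z (z : nat -> Z) n : span z (z n).
Proof.
exists n.+1, (fun i => (i == n)%:R); rewrite big_ord_recr/= eqxx scale1r.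
by rewrite big1 ?add0r// => i _; rewrite ltn_eqF// scale0r.
Qed.

Lemma span_dense Z (z : nat -> Z) : exists d : nat -> Z,
  forall y (e : R), span z y -> 0 < e -> exists n, rnorm (y - d n) < e.
Proof.
have [q qd] := scalars_dense R k.
exists (fun m => if @unpickle (seq nat) m is Some s
  then \sum_(i < size s) q (nth 0%N s i) *: z i else 0).
move=> _ e [n [c ->]] e0.
have t0 i : 0 < e / n.+1%:R / (1 + rnorm (z i)).
  by rewrite divr_gt0 ?divr_gt0// ltr_pwDl// rnorm_ge0.
have [m mP] := choice (fun i => qd (c i) _ (t0 i)).
exists (pickle (mkseq m n)); rewrite pickleK size_mkseq -sumrB.
apply: le_lt_trans (rnorm_sum _) _.
apply: (@le_lt_trans _ _ (\sum_(i < n) e / n.+1%:R)).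
  apply: ler_sum => i _; rewrite nth_mkseq// -scalerBl rnormZ.
  have z1 : 0 < 1 + rnorm (z i) by rewrite ltr_pwDl// rnorm_ge0.
  have := mP i; rewrite ltr_pdivlMr// => /ltW; apply: le_trans.
  by rewrite ler_wpM2l ?rnorm_ge0// lerDr.
rewrite sumr_const card_ord -[ltLHS]mulr_natr -mulrA gtr_pMr// mulrC.
by rewrite ltr_pdivrMr// mul1r ltr_nat.
Qed.

(** A subsequence along which a countable family norming the span of [z]
    converges. Two weak-star cluster points of it agree on this family, and
    each is within [2 w] of the span, which makes their distance at most [8 w]
    up to an arbitrarily small error. *)
Lemma quantitative_eberlein_smulian Z (z : nat -> Z) (M : R) :
  (forall n, rnorm (z n) <= M) ->
  exists s, {homo s : m n / (m < n)%N} /\ forall w : R,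
    (wk (range z) < w%:E)%E -> (delta (z \o s) <= (9 * w)%:E)%E.
Proof.
move=> zM; have [d dP] := span_dense z.
have [phi phiP] := choice (fun m => norming_functional (d m)).
have [U [UU Uoo]] := free_ultrafilter.
have /choice[L LP] : forall m, exists l : K^o,
    (phi m (z n) : K^o) @[n --> U] --> l.
  move=> m; apply: (@ultra_bounded_cvg R k _ _ _ M).
  apply: filterE => n /=; apply: le_trans (ler_rnorm_operator _ _) _.
  rewrite -[leRHS]mul1r ler_pM ?rnorm_ge0//.
  exact: (phiP m).1.
have [n N|s [sinc sP]] := @subsequence_ex (fun n m => forall j, (j <= n)%N ->
    rnorm (L j - phi j (z m) : K^o) < n.+1%:R^-1).
  have : U [set m | forall j : 'I_n.+1,
      rnorm (L j - phi j (z m) : K^o) < n.+1%:R^-1].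
    apply: filter_forall => j; have /cvg_rnormP := LP j; apply.
    by rewrite invr_gt0.
  have /Uoo UN := nbhs_infty_ge N.
  move=> /(filterI UN)/filter_ex[m [/= Nm mP]]; exists m => // j jn.
  exact: (mP (Ordinal (jn : (j < n.+1)%N))).
exists s; split=> // w wz.
have w0 : 0 < w by rewrite -lte_fin; apply: le_lt_trans wz; exact: wk_range_ge0.
(* all weak-star cluster points of the subsequence take the value [L m] at
   [phi m], whatever the indices [i n] along which they are reached *)
have cluster (i : nat -> nat) : (forall n, (n <= i n)%N) ->
    exists u : dual (dual Z), [/\
      forall f : dual Z, (f (z (s (i n))) : K^o) @[n --> U] --> (u f : K^o),
      forall m, u (phi m) = L m &
      exists2 e, span z e & rnorm (u - J e) < 2 * w].
  move=> ni; have [|u [_ uP]] := @functional_limit R k Z _ U (z \o s \o i) M UU.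
    by apply: filterE => n; exact: zM.
  exists u; split=> [//|m|].
    apply: (@cvg_scalar_uniq R k _ U _ _ (L m) _ (uP (phi m))).
    apply/cvg_rnormP => e e0.
    have small := near_infty_natSinv_lt (PosNum e0).
    have nm := Uoo _ (nbhs_infty_ge m).
    apply: filterS (filterI nm (Uoo _ small)) => n /= [mn].
    apply: lt_trans; have nin := ni n.
    apply: lt_le_trans (sP (i n) m (leq_trans mn nin)) _.
    by rewrite lef_pV2 ?posrE// ler_nat.
  have [y uy] : exists y, rnorm (u - J y) < w.
    apply: wk_lt_dist wz _.
    apply: (@weak_star_closure_limit R k (dual Z) _ U
      (fun n => J (z (s (i n))))) => //.
    by apply: filterE => n /=; exists (z (s (i n))) => //; exists (s (i n)).
  apply: near_subspace (span_subspace z) _ uP uy.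
  by apply: filterE => n; exact: span_mem.
apply: delta_le => f f1; apply: contrapT => nf.
have /choice[ij ijP] : forall n, exists p : nat * nat,
    [/\ (n <= p.1)%N, (n <= p.2)%N &
      9 * w < rnorm (f (z (s p.1) - z (s p.2)) : K^o)].
  move=> n; apply: contrapT => nn; apply: nf; exists n => i j ni nj.
  by rewrite leNgt; apply/negP => fij; apply: nn; exists (i, j).
have [|u [uf uphi [e1 e1z ue1]]] := cluster (fun n => (ij n).1).
  by move=> n; have [] := ijP n.
have [|v [vf vphi [e2 e2z ve2]]] := cluster (fun n => (ij n).2).
  by move=> n; have [] := ijP n.
have ez : span z (e1 - e2).
  have := (span_subspace z).2 (-1) e2 e1 e2z e1z.
  by rewrite scaleN1r addrC.
have w40 : 0 < w / 4 by rewrite divr_gt0.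
have [m em] := dP _ _ ez w40.
have uve : rnorm ((u - v) - J (e1 - e2)) <= 4 * w.
  rewrite embeddingB; have -> : u - v - (J e1 - J e2) = (u - J e1) - (v - J e2).
    by rewrite !opprB addrACA [RHS]addrACA (addrC (- v)).
  by apply: le_trans (ler_rnormB _ _) _; lra.
have dm : rnorm (d m) <= 4 * w + w / 4.
  have [phi1 <-] := phiP m.
  have -> : phi m (d m) =
      - ((u - v - J (e1 - e2)) (phi m) + phi m (e1 - e2 - d m)).
    rewrite (operatorB _ (e1 - e2)) !sub_operatorE uphi vphi.
    by rewrite subrr sub0r embeddingE addKr opprK.
  rewrite rnormN; apply: le_trans (rnormD _ _) _; apply: lerD.
    exact: le_trans (ler_rnorm_operator_unit _ phi1) uve.
  apply: le_trans (ler_rnorm_operator _ _) _; apply: le_trans (ltW em).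
  by rewrite ler_piMl ?rnorm_ge0.
have e12 : rnorm (e1 - e2) <= 4 * w + w / 4 + w / 4.
  rewrite -[e1 - e2](subrK (d m)); apply: le_trans (rnormD _ _) _.
  by rewrite addrC lerD// ltW.
have uv : rnorm (u f - v f : K^o) < 9 * w.
  have := ler_rnorm_operator_unit (u - v) f1.
  rewrite sub_operatorE => /le_lt_trans; apply.
  rewrite -[u - v](subrK (J (e1 - e2))); apply: le_lt_trans (rnormD _ _) _.
  by rewrite rnorm_embedding; lra.
pose h n : K^o := f (z (s (ij n).1) - z (s (ij n).2)).
have /cvg_rnormP fcv : h n @[n --> U] --> (u f - v f : K^o).
  rewrite /h.
  under eq_cvg do rewrite linearB.
  exact: cvgB (uf f) (vf f).
have r0 : 0 < 9 * w - rnorm (u f - v f : K^o) by rewrite subr_gt0.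
have [n /= fn] := filter_ex (fcv _ r0).
have [_ _] := ijP n; apply/negP; rewrite -leNgt.
have := rnorm_sub_ge (h n) (u f - v f : K^o).
by rewrite rnorm_distC; lra.
Qed.

End Eberlein.

(** * Operators into the space of bounded sequences *)

Section EllInfinity.
Context (R : realType) (k : scalar_kind).
Local Notation K := (scalars R k).
Local Notation J := (@canonical_embedding R k _).
Local Notation linf := (ell_infty R k).
Implicit Types (X : normedModType K) (a : linf) (m : dual linf).

Lemma ell_infty_coord a n : rnorm (a n) <= rnorm a.
Proof.
rewrite -[rnorm a]/(to_real (of_real k _)) of_realK.
by apply: sup_norm_ub => //; apply/bounded_sequenceP/ell_inftyP.
Qed.

Lemma ell_infty_rnorm_le a (c : R) :
  (forall n, rnorm (a n) <= c) -> rnorm a <= c.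
Proof.
move=> ac; rewrite -[rnorm a]/(to_real (of_real k _)) of_realK.
by apply: sup_norm_le => //; exists 0%N.
Qed.

Lemma ell_infty_ex (u : nat -> K^o) (M : R) : (forall n, rnorm (u n) <= M) ->
  exists a : linf, (a : nat -> K^o) = u.
Proof.
move=> uM; have uP : u \in @bounded_sequence R k.
  by apply/bounded_sequenceP; exists M => n _; exact: uM.
by exists (EllInfty uP).
Qed.

Lemma ell_inftyBE a b n : (a - b) n = a n - b n.
Proof. by []. Qed.

Lemma ell_infty_sumE N (F : 'I_N -> linf) n :
  (\sum_(i < N) F i) n = \sum_(i < N) F i n.
Proof.
elim: N F => [|N IH] F; first by rewrite !big_ord0.
by rewrite !big_ord_recr/= -IH.
Qed.

Lemma unit_vectors : exists e : nat -> linf, forall i n, e i n = (n == i)%:R.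
Proof.
have /choice[e eP] : forall i, exists a : linf,
    (a : nat -> K^o) = (fun n => (n == i)%:R).
  move=> i; apply: (@ell_infty_ex _ 1) => n.
  by case: eqP; rewrite ?rnorm1 ?rnorm0.
by exists e => i n; rewrite eP.
Qed.

Lemma phase (z : K) : exists c : K, rnorm (c : K^o) <= 1 /\
  c * z = of_real k (rnorm (z : K^o)).
Proof.
have [->|z0] := eqVneq z 0.
  by exists 0; rewrite !rnorm0 mulr0 of_real0.
exists (`|z| / z); split; last by rewrite divfK// rnormE.
rewrite -(ler_of_real k) rnormE of_real1.
by rewrite normrM normr_id normfV mulfV// normr_eq0.
Qed.

(** Yosida-Hewitt splitting: the values of [m] at the unit vectors are summable,
    and what remains of [m] only sees the tails of a sequence. *)
Lemma functional_tail m (e : nat -> linf) (r : R) :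
  (forall i n, e i n = (n == i)%:R) -> rnorm m <= 1 -> 0 < r ->
  exists N, forall a (M D : R), (forall n, rnorm (a n) <= M) ->
    (exists n0, forall n, (n0 <= n)%N -> rnorm (a n) <= D) ->
    rnorm (m a - \sum_(i < N) a i * m (e i) : K^o) <= D + M * r.
Proof.
move=> eE m1 r0.
pose S N := \sum_(i < N) rnorm (m (e i) : K^o).
have S1 N : S N <= 1.
  have [c cP] := choice (fun i => phase (m (e i))).
  pose b := \sum_(i < N) c i *: e i.
  have bE : m b = of_real k (S N).
    rewrite linear_sum /S; elim: (N) => [|n IH].
      by rewrite !big_ord0 of_real0.
    rewrite !big_ord_recr/= of_realD IH linearZ; congr (_ + _).
    exact: (cP n).2.
  have b1 : rnorm b <= 1.
    apply: ell_infty_rnorm_le => n; rewrite ell_infty_sumE.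
    have [nN|Nn] := ltnP n N.
      rewrite (bigD1 (Ordinal nN))//= big1 ?addr0.
        rewrite -[X in rnorm X]/(c n * e n n) eE eqxx mulr1.
        exact: (cP n).1.
      move=> i; rewrite -val_eqE/= => iN.
      by rewrite -[LHS]/(c i * e i n) eE eq_sym (negPf iN) mulr0.
    rewrite big1 ?rnorm0// => i _; rewrite -[LHS]/(c i * e i n) eE.
    by rewrite gtn_eqF ?mulr0// (leq_trans (ltn_ord i)).
  have := ler_rnorm_operator_unit m b1; rewrite bE rnorm_of_real ger0_norm.
    by move=> /le_trans; apply.
  by apply: sumr_ge0 => i _; exact: rnorm_ge0.
have Smono n p : S n <= S (n + p)%N.
  elim: p => [|p IH]; first by rewrite addn0.
  by rewrite addnS {2}/S big_ord_recr/= ler_wpDr ?rnorm_ge0.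
have SS : has_sup (range S).
  by split; [exists (S 0%N), 0%N|exists 1 => _ [n _ <-]].
(* the sums of [|m (e_i)|] over index sets beyond [N] are less than [r] *)
have [_ [N _ <-] SN] := sup_adherent r0 SS.
exists N => a M D aM [n0 aD].
have M0 : 0 <= M by exact: le_trans (rnorm_ge0 _) (aM 0%N).
have head p : rnorm (\sum_(i < N + p) a i * m (e i) -
    \sum_(i < N) a i * m (e i) : K^o) <= M * (S (N + p)%N - S N).
  elim: p => [|p IH]; first by rewrite addn0 !subrr rnorm0 mulr0.
  rewrite addnS /S !big_ord_recr/= -/(S _) -/(S _).
  rewrite [in leLHS]addrAC [in leRHS]addrAC mulrDr.
  apply: le_trans (rnormD _ _) _; apply: lerD => //.
  by rewrite rnormM ler_wpM2r ?rnorm_ge0.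
have tail : rnorm (m a - \sum_(i < N + n0) a i * m (e i) : K^o) <= D.
  have -> : m a - \sum_(i < N + n0) a i * m (e i) =
      m (a - \sum_(i < N + n0) (a i : K) *: e i).
    have sumE : m (\sum_(i < N + n0) (a i : K) *: e i) =
        \sum_(i < N + n0) a i * m (e i).
      by rewrite linear_sum; apply: eq_bigr => i _; rewrite linearZ.
    by rewrite operatorB sumE.
  apply: le_trans (ler_rnorm_operator m _) _.
  rewrite -[leRHS]mul1r ler_pM ?rnorm_ge0//.
  apply: ell_infty_rnorm_le => n; rewrite ell_inftyBE ell_infty_sumE.
  have [nN|Nn] := ltnP n (N + n0).
    rewrite (bigD1 (Ordinal nN))//= big1 ?addr0.
      rewrite -[X in _ - X]/(a n * e n n) eE eqxx mulr1 subrr rnorm0.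
      exact: le_trans (rnorm_ge0 _) (aD n0 (leqnn _)).
    move=> i; rewrite -val_eqE/= => iN.
    by rewrite -[LHS]/(a i * e i n) eE eq_sym (negPf iN) mulr0.
  rewrite big1 ?subr0; first by apply: aD; apply: leq_trans Nn; exact: leq_addl.
  move=> i _; rewrite -[LHS]/(a i * e i n) eE.
  by rewrite gtn_eqF ?mulr0// (leq_trans (ltn_ord i)).
apply: le_trans (rnorm_triangle (\sum_(i < N + n0) a i * m (e i)) _ _) _.
apply: lerD tail _; apply: le_trans (head n0) _; rewrite ler_wpM2l//.
have : S (N + n0)%N <= sup (range S).
  by apply: ub_le_sup; [case: SS|exists (N + n0)%N].
lra.
Qed.

(** A sequence [g] in the dual whose weak-star cluster points in the third dual
    have norm at most [D] defines an operator into the bounded sequences with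
    small weak noncompactness. Elements of the weak-star closure of the image of
    the ball are [T^** v]; the sequence [v (g_n)] is close to it, because the
    summable parts of functionals do not distinguish the two. *)
Lemma sequence_operator X (g : nat -> dual X) (M D : R) :
  (forall n, rnorm (g n) <= M) ->
  (forall v : dual (dual X), rnorm v <= 1 ->
    exists n0, forall n, (n0 <= n)%N -> rnorm (v (g n) : K^o) <= D) ->
  exists T : operator X linf, (forall x n, T x n = g n x) /\
    (wk_op T <= (2 * D)%:E)%E.
Proof.
move=> gM gD.
have M0 : 0 <= M by exact: le_trans (rnorm_ge0 _) (gM 0%N).
have gx x n : rnorm (g n x : K^o) <= M * rnorm x.
  by apply: le_trans (ler_rnorm_operator _ _) _; rewrite ler_wpM2r ?rnorm_ge0.
have /choice[t tE] := fun x => @ell_infty_ex (fun n => g n x) _ (gx x).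
have tl : linear t.
  move=> a x y; apply/val_inj/funext => n.
  rewrite -[RHS]/(a * t x n + t y n) -[LHS]/(t (a *: x + y) n) !tE.
  by rewrite linearP.
have [|T [TE _]] := operator_ex tl M0.
  by move=> x; apply: ell_infty_rnorm_le => n; rewrite tE.
have TgE x n : T x n = g n x by rewrite TE tE.
exists T; split=> //.
apply: wk_le_dist => _ /closure_image_bidual[v [v1 ->]].
have vg n : rnorm (v (g n) : K^o) <= M.
  apply: le_trans (ler_rnorm_operator v _) _; rewrite -[leRHS]mul1r.
  by rewrite ler_pM ?rnorm_ge0 ?gM.
have [y yE] := @ell_infty_ex (fun n => v (g n)) M vg.
exists y; apply: rnorm_operator_unit_le => m m1; apply/ler_addgt0Pr => c c0.
have [e eE] := unit_vectors.
have M1 : 0 < 2 * (1 + M) by rewrite mulr_gt0// ltr_pwDl.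
have r0 : 0 < c / (2 * (1 + M)) by rewrite divr_gt0.
set r := c / _ in r0.
have [N NP] := functional_tail eE m1 r0.
have rM : M * r <= c / 2.
  have M1' : 1 + M != 0 by rewrite gt_eqF// ltr_pwDl.
  have rE : (1 + M) * r = c / 2 by rewrite /r; field.
  by lra.
pose q : dual X := \sum_(i < N) m (e i) *: g i.
have qE x : q x = \sum_(i < N) m (e i) * g i x.
  rewrite -[q x]/(J x q) linear_sum; apply: eq_bigr => i _.
  by rewrite linearZ.
have Tq : rnorm (adjoint T m - q) <= D + M * r.
  apply: rnorm_operator_unit_le => x x1; rewrite sub_operatorE adjointE qE.
  have -> : \sum_(i < N) m (e i) * g i x = \sum_(i < N) T x i * m (e i).
    by apply: eq_bigr => i _; rewrite TgE mulrC.
  apply: NP => [n|].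
    by rewrite TgE; apply: le_trans (ler_rnorm_operator_unit _ x1) _.
  have [|n0 n0P] := gD (J x); first by rewrite rnorm_embedding.
  by exists n0 => n /n0P; rewrite TgE.
have yq : rnorm (m y - v q : K^o) <= D + M * r.
  have -> : v q = \sum_(i < N) y i * m (e i).
    rewrite linear_sum; apply: eq_bigr => i _.
    by rewrite linearZ yE -[LHS]/(_ * _) mulrC.
  by apply: NP => [n|]; rewrite yE//; exact: gD.
have -> : (adjoint (adjoint T) v - J y) m = v (adjoint T m - q) - (m y - v q).
  rewrite sub_operatorE embeddingE adjointE operatorB opprB addrA subrK.
  by [].
apply: le_trans (ler_rnormB _ _) _.
have vT : rnorm (v (adjoint T m - q) : K^o) <= D + M * r.
  apply: le_trans (ler_rnorm_operator v _) _; apply: le_trans Tq.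
  by rewrite ler_piMl ?rnorm_ge0.
by lra.
Qed.

End EllInfinity.

(** * Weakly null sequences and oscillation of images *)

Section WeaklyNull.
Context (R : realType) (k : scalar_kind).
Local Notation K := (scalars R k).
Local Notation J := (@canonical_embedding R k _).
Implicit Types X Y Z : normedModType K.

Lemma weakly_nullP X (x : nat -> X) : weakly_null x <->
  forall (f : dual X) (e : R), 0 < e ->
    exists N, forall n, (N <= n)%N -> rnorm (f (x n) : K^o) < e.
Proof.
split=> [x0 f e e0|x0 f].
  have /cvg_rnormP/(_ _ e0)[N _ NP] := x0 f.
  by exists N => n /NP /=; rewrite sub0r rnormN.
apply/cvg_rnormP => e e0; have [N NP] := x0 f e e0.
by exists N => // n /NP /=; rewrite sub0r rnormN.
Qed.

Lemma weakly_cauchyP X (x : nat -> X) : weakly_cauchy x <->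
  forall (f : dual X) (e : R), 0 < e -> exists N, forall i j,
    (N <= i)%N -> (N <= j)%N -> rnorm (f (x i - x j) : K^o) < e.
Proof.
split=> [xc f e e0|xc f].
  have e2 := of_real_gt0 k (divr_gt0 e0 (ltr0n R 2)).
  have /cauchyP/(_ _ e2)[z [N _ NP]] := xc f.
  exists N => i j /NP /= zi /NP /= zj; rewrite operatorB.
  have ball_rnorm (y : K^o) :
      ball z (of_real k (e / 2)) y -> rnorm (z - y) < e / 2.
    by rewrite -ball_normE/= -rnormE ltr_of_real.
  apply: le_lt_trans (rnorm_triangle z _ _) _; rewrite [ltRHS]splitr.
  by rewrite ltrD// ?(rnorm_distC _ z) ball_rnorm.
apply/cauchyP => _ /gt0_of_real[e e0 ->]; have [N NP] := xc f e e0.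
exists (f (x N)); exists N => // n /= Nn.
by rewrite -ball_normE/= -rnormE ltr_of_real -operatorB NP.
Qed.

Lemma weakly_null_cauchy X (x : nat -> X) : weakly_null x -> weakly_cauchy x.
Proof.
move=> /weakly_nullP x0; apply/weakly_cauchyP => f e e0.
have [N NP] := x0 f _ (divr_gt0 e0 (ltr0n R 2)).
exists N => i j /NP xi /NP xj; rewrite operatorB.
by apply: le_lt_trans (ler_rnormB _ _) _; rewrite [ltRHS]splitr ltrD.
Qed.

Lemma weakly_null_subseq X (x : nat -> X) (s : nat -> nat) :
  (forall n, (n <= s n)%N) -> weakly_null x -> weakly_null (x \o s).
Proof.
move=> sn /weakly_nullP x0; apply/weakly_nullP => f e e0.
have [N NP] := x0 f e e0; exists N => n Nn.
by apply: NP; exact: leq_trans (sn n).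
Qed.

Lemma tail_osc_ge (a : nat -> nat -> \bar R) (c : \bar R) :
  (forall n0, exists i j, [/\ (n0 <= i)%N, (n0 <= j)%N & (c <= a i j)%E]) ->
  (c <= tail_osc a)%E.
Proof.
move=> ac; apply: le_ereal_inf_tmp => _ [n0 _ <-].
have [i [j [ni nj cij]]] := ac n0; apply: le_trans cij _.
by apply: ereal_sup_ubound; exists i => //; exists j.
Qed.

Lemma tail_osc_gt (a : nat -> nat -> \bar R) (c : \bar R) :
  (c < tail_osc a)%E ->
  forall n0, exists i j, [/\ (n0 <= i)%N, (n0 <= j)%N & (c < a i j)%E].
Proof.
move=> ca n0; have : (c < ereal_sup [set a i j | i in [set i | (n0 <= i)%N]
    & j in [set j | (n0 <= j)%N]])%E.
  by apply: lt_le_trans ca _; apply: ereal_inf_lbound; exists n0.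
by move=> /ereal_sup_gt[_ [i /= ni [j /= nj <-]] cij]; exists i, j.
Qed.

Lemma bounded_fun_rnorm X (f : nat -> X) :
  bounded_fun f <-> exists M : R, forall n, rnorm (f n) <= M.
Proof.
have PF : ProperFilter (globally [set: nat]).
  exact: (@globally_properfilter _ _ 0%N).
split=> [/ex_bound[M fM]|[M fM]].
  exists (to_real M) => n; rewrite -(ler_of_real k) rnormE.
  have fn : `|f n| <= M by exact: fM.
  by rewrite to_realK// (le_trans _ fn).
apply/(@ex_bound _ _ X f); exists (of_real k M) => n _ /=.
by rewrite -rnormE ler_of_real.
Qed.

Lemma lte_scale (C : R) (y : \bar R) (w : R) : 0 < C -> (0 <= y)%E ->
  (y < w%:E)%E -> (C%:E * y < (C * w)%:E)%E.
Proof.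
by case: y => [y|//|//] C0 _; rewrite -EFinM !lte_fin ltr_pM2l.
Qed.

Lemma limn_esup_ge (u : nat -> \bar R) (c : \bar R) :
  (forall n, (c <= u n)%E) -> (c <= limn_esup u)%E.
Proof.
move=> cu; apply: le_ereal_inf_tmp => _ [A [N _ NA] <-].
apply: le_trans (cu N) _; apply: ereal_sup_ubound; exists N => //.
by apply: NA => /=.
Qed.

(** An ultrafilter on the natural numbers is principal or free. *)
Lemma ultra_nat (V : set_system nat) : UltraFilter V ->
  (exists n, V [set n]) \/ \oo `<=` V.
Proof.
move=> VU; have fin N : V [set n | (n < N)%N] -> exists n, V [set n].
  elim: N => [|N IH] VN.
    by have [n] := filter_ex VN; rewrite /= ltn0.
  have [VsN|VsN] := in_ultra_setVsetC [set N] VU; first by exists N.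
  apply: IH; apply: filterS (filterI VN VsN) => n [/= nN /eqP nN'].
  by rewrite ltn_neqAle nN' -ltnS.
have [[N VN]|nN] := pselect (exists N, ~ V [set n | (N <= n)%N]); last first.
  right=> A [N _ NA]; apply: filterS NA _; apply: contrapT => nV.
  by apply: nN; exists N.
left; apply: (fin N); have [//|] := in_ultra_setVsetC [set n | (N <= n)%N] VU.
by apply: filterS => n /= /negP; rewrite -ltnNge.
Qed.

(** Elements of the weak-star closure of the range are either terms of the
    sequence or limits along free ultrafilters. *)
Lemma wk_range_le Z (g : nat -> Z) (w : R) : 0 <= w ->
  (forall f : dual Z, rnorm f <= 1 ->
    exists N, forall n, (N <= n)%N -> rnorm (f (g n) : K^o) <= w) ->
  (wk (range g) <= w%:E)%E.
Proof.
move=> w0 gw; apply: wk_le_dist => u; rewrite image_comp.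
move=> /weak_star_closure_ultra[V [VU _ uV]].
have [[n Vn]|Voo] := ultra_nat VU.
  exists (g n); suff -> : u = J (g n) by rewrite subrr rnorm0.
  apply/val_inj/funext => f.
  apply: (@cvg_scalar_uniq R k _ V _ (u f) (f (g n)) _ (uV f)).
  apply/cvg_rnormP => e e0; apply: filterS Vn => _ -> /=.
  by rewrite subrr rnorm0.
exists 0; apply: rnorm_operator_unit_le => f f1.
rewrite sub_operatorE embeddingE linear0.
have uf : ((J \o g) n f : K^o) @[n --> V] --> (u f : K^o) := uV f.
apply: cvg_rnorm_le uf _; have [N NP] := gw f f1.
by apply: Voo; exists N => // n /NP /=; rewrite subr0.
Qed.

(** The canonical image of a weakly compact set is weak-star compact, hence
    weak-star closed. *)
Lemma weakly_compact_wk X (F : set X) (w : R) : weakly_compact F -> 0 < w ->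
  (wk F < w%:E)%E.
Proof.
move=> cF w0; apply: le_lt_trans (_ : (0%:E < w%:E)%E); last by rewrite lte_fin.
apply: wk_le_dist => u /weak_star_closure_ultra[V [VU VF uV]].
have [x0 Fx0 Vx0] := @ultra_compact_cvg (weak X) X V id F VU cF VF.
exists x0; suff -> : u = J x0 by rewrite subrr rnorm0.
apply/val_inj/funext => f.
apply: (@cvg_scalar_uniq R k _ V _ (u f) (f x0) _ (uV f)).
have fc := @pointwise_eval_continuous X (dual X) K^o (fun x g => g x) f x0.
by move=> B /fc; apply: Vx0.
Qed.

(** By [quantitative_eberlein_smulian] some subsequence is weakly Cauchy, and by
    compactness it has a weak cluster point in [F]. *)
Lemma eberlein_smulian X (F : set X) (x : nat -> X) :
  weakly_compact F -> F `<=` unit_ball X -> (forall n, F (x n)) ->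
  exists s x0, [/\ {homo s : m n / (m < n)%N}, F x0 &
    weakly_null (fun n => x (s n) - x0)].
Proof.
move=> cF F1 Fx.
have [|s [sinc sE]] := @quantitative_eberlein_smulian R k X x 1.
  by move=> n; apply/rnorm_le1/F1.
have delta0 w : 0 < w -> (delta (x \o s) <= (9 * w)%:E)%E.
  move=> w0; apply: sE; apply: le_lt_trans (weakly_compact_wk cF w0).
  by apply: wkS => _ [n _ <-].
have [U [UU Uoo]] := free_ultrafilter.
have [|x0 Fx0 Ux0] := @ultra_compact_cvg (weak X) nat U (x \o s) F UU cF.
  by apply: filterE => n; exact: Fx.
exists s, x0; split=> //; apply/weakly_nullP => f e e0.
have f1 : 0 < 1 + rnorm f by rewrite ltr_pwDl ?rnorm_ge0.
pose g : dual X := of_real k (1 + rnorm f)^-1 *: f.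
have g1 : rnorm g <= 1.
  rewrite rnormZ rnorm_of_real gtr0_norm ?invr_gt0//.
  by rewrite mulrC ler_pdivrMr// mul1r lerDr.
have c0 : 0 < e / 2 / (1 + rnorm f) by rewrite !divr_gt0.
set c := e / 2 / _ in c0.
have [|N NP] := @delta_lt R k X (x \o s) c g _ g1.
  apply: le_lt_trans (delta0 (c / 10) _) _; first by rewrite divr_gt0.
  by rewrite lte_fin; lra.
exists N => n Nn; rewrite operatorB rnorm_distC.
apply: (@le_lt_trans _ _ (e / 2)); last by lra.
have fx0 : (f (x (s n)) : K^o) @[n --> U] --> (f x0 : K^o).
  have fc := @pointwise_eval_continuous X (dual X) K^o (fun x g => g x) f x0.
  by move=> B /fc; apply: Ux0.
apply: cvg_rnorm_le fx0 _; apply: Uoo; exists N => // i /= Ni.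
have := ltW (NP i n Ni Nn); rewrite scale_operatorE rnormZ rnorm_of_real.
by rewrite gtr0_norm ?invr_gt0// mulrC ler_pM2r ?invr_gt0// operatorB.
Qed.

(** An ultrafilter containing the set contains [0] or is the image of an
    ultrafilter of indices, which is principal or free. *)
Lemma weakly_null_compact X (x : nat -> X) : weakly_null x ->
  weakly_compact (0 |` range x).
Proof.
move=> x0; rewrite /weakly_compact compact_ultra => V VU VF.
have cvgV (y : X) W : UltraFilter W -> (V : set_system X) `<=` x @ W ->
    x @ W --> (y : weak X) -> V --> (y : weak X).
  move=> WU VW Wy B nB; have [//|VB] := in_ultra_setVsetC B VU.
  by have [n []] := filter_ex (filterI (Wy B nB) (VW _ VB)).
have [V0|Vn0] := in_ultra_setVsetC [set (0 : weak X)] VU.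
  exists 0; split; first by left.
  move=> B nB; apply: filterS V0 => _ ->.
  exact: (@nbhs_singleton (weak X) 0 B nB).
have Vx : V (range x).
  apply: filterS (filterI VF Vn0) => y [[y0|//] yn0].
  by case: yn0.
pose G := filter_from V (fun B => x @^-1` B).
have GP : ProperFilter G.
  apply: filter_from_proper; last first.
    move=> B VB; have [_ [[n _ <-] Bn]] := filter_ex (filterI Vx VB).
    by exists n.
  apply: filter_from_filter; first by exists setT; exact: filterT.
  by move=> B C VB VC; exists (B `&` C) => //; exact: filterI.
have [W [WU GW]] := ultraFilterLemma GP.
have VW : (V : set_system X) `<=` x @ W by move=> B VB; apply: GW; exists B.
have [[n Wn]|Woo] := ultra_nat WU.
  exists (x n); split; first by right; exists n.
  apply: cvgV VW _ => B nB.
  suff : W (x @^-1` B) by [].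
  by apply: filterS Wn => _ ->; exact: (@nbhs_singleton (weak X) (x n) B nB).
exists 0; split; first by left.
apply: cvgV VW _; apply: pointwise_cvg => f.
move=> B nB; apply: Woo; apply: (x0 f); suff <- : f 0 = 0 by [].
exact: linear0.
Qed.

End WeaklyNull.

(** * Bounds by weak noncompactness imply each other *)

Section Equivalence.
Context (R : realType) (k : scalar_kind) (X : normedModType (scalars R k)).
Local Notation K := (scalars R k).
Local Notation J := (@canonical_embedding R k _).

Definition weakly_null_bound (C : R) : Prop :=
  forall (x : nat -> X) (f : nat -> dual X),
    weakly_null x -> (forall n, unit_ball X (x n)) -> bounded_fun f ->
    (limn_esup (fun n => (rnorm (f n (x n)))%:E) <= C%:E * wk (range f))%E.

(** Differences of a weakly Cauchy sequence along which [T] oscillates are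
    weakly null; they are paired with the functionals [T^* y_n], where [y_n]
    norms their images. *)
Lemma cc_le_of_weakly_null_bound (C : R) : 0 < C -> weakly_null_bound C ->
  forall (Y : normedModType K) (T : operator X Y),
    (cc T <= (2 * C)%:E * wk_op (adjoint T))%E.
Proof.
move=> C0 XC Y T.
apply: lee_mulr_limit; [by rewrite mulr_gt0|exact: wk_op_ge0|].
move=> w Tw; apply: ge_ereal_sup => _ [x [/weakly_cauchyP xc x1] <-].
rewrite leNgt; apply/negP => /tail_osc_gt Tx.
have /choice[ij ijP] : forall n, exists p : nat * nat,
    [/\ (n <= p.1)%N, (n <= p.2)%N & 2 * C * w < rnorm (T (x p.1) - T (x p.2))].
  by move=> n; have [i [j [ni nj]]] := Tx n; rewrite lte_fin; exists (i, j).
have /choice[y yP] := fun n =>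
  norming_functional (T (x (ij n).1) - T (x (ij n).2)).
pose h := of_real k (1 / 2 : R).
pose z n : X := h *: (x (ij n).1 - x (ij n).2).
have h2 : rnorm (h : K^o) = 1 / 2 by rewrite rnorm_of_real ger0_norm.
have znull : weakly_null z.
  apply/weakly_nullP => f e e0; have [N NP] := xc f e e0.
  exists N => n Nn; have [ni nj _] := ijP n.
  have := NP _ _ (leq_trans Nn ni) (leq_trans Nn nj).
  rewrite linearZ rnormM h2; apply: le_lt_trans.
  by rewrite ler_piMl ?rnorm_ge0//; lra.
have z1 n : unit_ball X (z n).
  apply/rnorm_le1; rewrite rnormZ h2.
  have := ler_rnormB (x (ij n).1) (x (ij n).2).
  by have /rnorm_le1 := x1 (ij n).1; have /rnorm_le1 := x1 (ij n).2; lra.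
pose f n := adjoint T (y n).
have fb : bounded_fun f.
  apply/bounded_fun_rnorm; exists (rnorm (adjoint T)) => n.
  exact: ler_rnorm_operator_unit (yP n).1.
have := XC z f znull z1 fb; apply/negP; rewrite -ltNge.
apply: (@lt_le_trans _ _ (C * w)%:E).
  apply: lte_scale => //; first exact: wk_range_ge0.
  apply: le_lt_trans Tw; apply: wkS => _ [n _ <-].
  by exists (y n) => //; apply/rnorm_le1; exact: (yP n).1.
apply: limn_esup_ge => n; rewrite lee_fin.
rewrite -[f n (z n)]/(y n (T (z n))) !operatorZ rnormZ h2 operatorB.
by rewrite (yP n).2; have [_ _] := ijP n; lra.
Qed.

(** If [f_i - f_j] is large at points [x] of a weakly compact set, these points
    may be taken convergent to some [x_0]; the differences are small at [x_0],
    so they are large at the weakly null sequence [x - x_0]. *)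
Lemma ca_rho_star_le_of_weakly_null_bound (C : R) :
  0 < C -> weakly_null_bound C ->
  forall f : nat -> dual X, bounded_fun f ->
    (ca_rho_star f <= (2 * C + 2)%:E * delta f)%E.
Proof.
move=> C0 XC f /bounded_fun_rnorm[M fM].
apply: lee_mulr_limit; [by rewrite addr_gt0 ?mulr_gt0|exact: delta_ge0|].
move=> w fw; apply: ge_ereal_sup => _ [F [cF F1] <-].
have w0 : 0 < w by rewrite -lte_fin; apply: le_lt_trans fw; exact: delta_ge0.
rewrite leNgt; apply/negP => /tail_osc_gt Fw.
have /choice[q qP] : forall n, exists q : nat * nat * X,
    [/\ (n <= q.1.1)%N, (n <= q.1.2)%N, F q.2 &
      (2 * C + 2) * w < rnorm ((f q.1.1 - f q.1.2) q.2 : K^o)].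
  move=> n; have [i [j [ni nj]]] := Fw n.
  move=> /ereal_sup_gt[_ [x Fx <-]]; rewrite lte_fin => cx.
  by exists ((i, j), x).
have [|s [x0 [sinc Fx0 sx0]]] :=
    @eberlein_smulian R k X F (fun n => (q n).2) cF F1.
  by move=> n; have [] := qP n.
have x01 : rnorm (J x0) <= 1 by rewrite rnorm_embedding; apply/rnorm_le1/F1.
pose g0 n := f (q (s n)).1.1 - f (q (s n)).1.2.
have g0v (v : dual (dual X)) : rnorm v <= 1 ->
    exists N, forall n, (N <= n)%N -> rnorm (v (g0 n) : K^o) < w.
  move=> v1; have [N NP] := delta_lt fw v1; exists N => n Nn.
  have [ni nj _ _] := qP (s n); have sn := increasing_ge_id sinc n.
  by apply: NP; [exact: leq_trans Nn (leq_trans sn ni)|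
    exact: leq_trans Nn (leq_trans sn nj)].
have [N NP] := g0v _ x01.
pose h := of_real k (1 / 2 : R).
have h2 : rnorm (h : K^o) = 1 / 2 by rewrite rnorm_of_real ger0_norm.
pose g n := g0 (N + n)%N.
pose y n : X := h *: ((q (s (N + n)%N)).2 - x0).
have ynull : weakly_null y.
  apply/weakly_nullP => a e e0; have /weakly_nullP/(_ a e e0)[N' N'P] := sx0.
  exists N' => n Nn; rewrite linearZ rnormM h2.
  have := N'P (N + n)%N (leq_trans Nn (leq_addl _ _)); apply: le_lt_trans.
  by rewrite ler_piMl ?rnorm_ge0//; lra.
have y1 n : unit_ball X (y n).
  apply/rnorm_le1; rewrite rnormZ h2.
  have [_ _ /F1/rnorm_le1 q1 _] := qP (s (N + n)%N).
  have /rnorm_le1 := F1 _ Fx0.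
  by have := ler_rnormB (q (s (N + n)%N)).2 x0; lra.
have gb : bounded_fun g.
  apply/bounded_fun_rnorm; exists (M + M) => n.
  by apply: le_trans (ler_rnormB _ _) _; apply: lerD; exact: fM.
have := XC y g ynull y1 gb; apply/negP; rewrite -ltNge.
apply: (@lt_le_trans _ _ (C * w + w / 2)%:E).
  apply: (@le_lt_trans _ _ (C * w)%:E); last by rewrite lte_fin; lra.
  rewrite EFinM; apply: lee_wpmul2l; first by rewrite lee_fin ltW.
  apply: wk_range_le => [|v v1]; first exact: ltW.
  have [N' N'P] := g0v v v1; exists N' => n Nn; apply/ltW/N'P.
  exact: leq_trans Nn (leq_addl _ _).
apply: limn_esup_ge => n; rewrite lee_fin operatorZ rnormZ h2 operatorB.
have [_ _ _] := qP (s (N + n)%N); rewrite -[_ - _]/(g n).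
have := NP (N + n)%N (leq_addr _ _); rewrite embeddingE -/(g n).
by have := rnorm_sub_ge (g n (q (s (N + n)%N)).2 : K^o) (g n x0 : K^o); lra.
Qed.

Lemma ca_rho_star_tilde_le_of_delta (C : R) : 0 < C ->
  (forall f : nat -> dual X, bounded_fun f ->
    (ca_rho_star f <= C%:E * delta f)%E) ->
  forall f : nat -> dual X, bounded_fun f ->
    (ca_rho_star_tilde f <= (C * 9)%:E * wk (range f))%E.
Proof.
move=> C0 XC f /bounded_fun_rnorm[M fM].
apply: lee_mulr_limit; [by rewrite mulr_gt0|exact: wk_range_ge0|move=> w fw].
have [s [sinc sw]] := quantitative_eberlein_smulian fM.
apply: (@le_trans _ _ (ca_rho_star (f \o s))).
  by apply: ereal_inf_lbound; exists s.
apply: le_trans (XC _ _) _; first by apply/bounded_fun_rnorm; exists M => n /=.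
rewrite -mulrA EFinM; apply: lee_wpmul2l; first by rewrite lee_fin ltW.
exact: sw.
Qed.

(** A weakly null sequence together with 0 is weakly compact. Along a
    subsequence of nearly minimal oscillation on this set, [f_n (x_n)] is close
    to [f_N (x_n)] with [N] fixed, and the latter tends to 0. *)
Lemma weakly_null_bound_of_tilde (C : R) : 0 < C ->
  (forall f : nat -> dual X, bounded_fun f ->
    (ca_rho_star_tilde f <= C%:E * wk (range f))%E) ->
  weakly_null_bound (C + 1).
Proof.
move=> C0 XC x f xnull x1 /bounded_fun_rnorm[M fM].
apply: lee_mulr_limit; [by rewrite addr_gt0|exact: wk_range_ge0|move=> w fw].
have w0 : 0 < w by rewrite -lte_fin; apply: le_lt_trans fw; exact: wk_range_ge0.
apply: limn_esup_le => s sinc sw.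
have : (ca_rho_star_tilde (f \o s) < (C * w)%:E)%E.
  apply: le_lt_trans (XC _ _) _.
    by apply/bounded_fun_rnorm; exists M => n /=.
  apply: lte_scale => //; first exact: wk_range_ge0.
  by apply: le_lt_trans fw; apply: wkS => _ [n _ <-]; exists (s n).
move=> /ereal_inf_lt[_ [p pinc <-] fpw].
pose t := s \o p.
have tn n : (n <= t n)%N.
  exact: leq_trans (increasing_ge_id pinc n) (increasing_ge_id sinc _).
pose F : set X := 0 |` range x.
have F1 : F `<=` unit_ball X.
  by move=> _ [->|[n _ <-]//]; apply/rnorm_le1; rewrite rnorm0 ler01.
have : (tail_osc (fun i j => ereal_sup
    [set (rnorm ((f (t i) - f (t j)) a : K^o))%:E | a in F]) < (C * w)%:E)%E.
  apply: le_lt_trans fpw; apply: ereal_sup_ubound; exists F => //.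
  by split=> //; exact: weakly_null_compact.
move=> /tail_osc_lt[N NP].
have /weakly_nullP/(_ (f (t N)) w w0)[N' N'P] := weakly_null_subseq tn xnull.
pose n := maxn N N'.
have := sw (p n); rewrite lte_fin -[s (p n)]/(t n).
have small : rnorm ((f (t N) - f (t n)) (x (t n)) : K^o) < C * w.
  rewrite -lte_fin; apply: le_lt_trans (NP N n (leqnn _) (leq_maxl _ _)).
  by apply: ereal_sup_ubound; exists (x (t n)) => //; right; exists (t n).
have := N'P n (leq_maxr _ _) => /= fN; rewrite sub_operatorE in small.
have := rnorm_sub_ge (f (t n) (x (t n)) : K^o) (f (t N) (x (t n)) : K^o).
by rewrite rnorm_distC; lra.
Qed.

(** Pass to a subsequence of [f] with few weak-star cluster points, and subtract
    from each term an earlier one at which it is almost null: the resulting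
    sequence is still large at the given weakly null sequence, and
    [sequence_operator] applies to it. *)
Lemma weakly_null_bound_of_cc (C : R) : 0 < C ->
  (forall (T : operator X (ell_infty R k)) (w : R), 0 < w ->
    (wk_op T <= w%:E)%E -> (cc T <= (C * w)%:E)%E) ->
  weakly_null_bound (20 * C + 2).
Proof.
move=> C0 XC x f xnull x1 /bounded_fun_rnorm[M fM].
apply: lee_mulr_limit; [by rewrite addr_gt0 ?mulr_gt0|exact: wk_range_ge0|].
move=> w fw.
have w0 : 0 < w by rewrite -lte_fin; apply: le_lt_trans fw; exact: wk_range_ge0.
apply: limn_esup_le => s sinc sw.
have [|p [pinc pw]] := @quantitative_eberlein_smulian R k (dual X) (f \o s) M.
  by move=> n; exact: fM.
have fpw : (delta (f \o s \o p) < (10 * w)%:E)%E.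
  apply: le_lt_trans (pw w _) _; last by rewrite lte_fin; lra.
  by apply: le_lt_trans fw; apply: wkS => _ [n _ <-]; exists (s n).
pose t := s \o p.
have tn n : (n <= t n)%N.
  exact: leq_trans (increasing_ge_id pinc n) (increasing_ge_id sinc _).
have tnull : weakly_null (x \o t) by exact: weakly_null_subseq xnull.
have [n N|b [binc bP]] := @subsequence_ex (fun n m =>
    rnorm (f (t n) (x (t m)) : K^o) < w).
  have /weakly_nullP/(_ (f (t n)) w w0)[N' N'P] := tnull.
  by exists (maxn N N'); [exact: leq_maxl|exact: N'P (leq_maxr _ _)].
pose g n := f (t (b n)) - f (t n).
have gM n : rnorm (g n) <= M + M.
  by apply: le_trans (ler_rnormB _ _) _; apply: lerD; exact: fM.
have gD (v : dual (dual X)) : rnorm v <= 1 ->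
    exists N, forall n, (N <= n)%N -> rnorm (v (g n) : K^o) <= 10 * w.
  move=> v1; have [N NP] := delta_lt fpw v1; exists N => n Nn.
  by apply/ltW/NP => //; exact: leq_trans (increasing_ge_id binc n).
have [T [TE Tw]] := sequence_operator gM gD.
have w20 : 0 < 2 * (10 * w) by rewrite !mulr_gt0.
have := XC T _ w20 Tw; apply/negP; rewrite -ltNge.
(* interleaving with 0 makes the image oscillate by the size of its terms *)
pose y n : X := if odd n then 0 else x (t (b n./2)).
have y1 n : unit_ball X (y n).
  rewrite /y; case: ifP => _; last exact: x1.
  by apply/rnorm_le1; rewrite rnorm0 ler01.
have ynull : weakly_null y.
  apply/weakly_nullP => a e e0; have /weakly_nullP/(_ a e e0)[N NP] := tnull.
  exists N.*2 => n Nn; rewrite /y; case: ifP => _.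
    by rewrite linear0 rnorm0.
  apply: NP; apply: leq_trans (increasing_ge_id binc _).
  by rewrite -[N]doubleK; exact: half_leq.
apply: (@lt_le_trans _ _ (ca (T \o y))); last first.
  apply: ereal_sup_ubound; exists y => //; split=> //.
  exact: weakly_null_cauchy.
apply: (@lt_le_trans _ _ ((20 * C + 1) * w)%:E); first by rewrite lte_fin; lra.
apply: tail_osc_ge => n; exists n.*2, n.*2.+1; split.
- by rewrite -addnn leq_addl.
- by rewrite -addnn leqW// leq_addl.
rewrite lee_fin /y /= odd_double/= doubleK linear0 subr0.
apply: le_trans (ell_infty_coord _ n); rewrite TE sub_operatorE.
set a := x (t (b n)).
have := rnorm_sub_ge (f (t (b n)) a : K^o) (f (t n) a : K^o).
have := sw (p (b n)); rewrite lte_fin -[s (p (b n))]/(t (b n)) -/a.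
by have := bP n; rewrite -/a; lra.
Qed.

End Equivalence.

Local Open Scope ereal_scope.

Theorem theorem5p4 (R : realType) (k : scalar_kind)
    (X : completeNormedModType (scalars R k)) :
  [<->
   (* (i) *)
   exists C : R, (0 < C)%R /\
     forall (Y : completeNormedModType (scalars R k)) (T : operator X Y),
       cc T <= C%:E * wk_op (adjoint T);
   (* (ii) *)
   exists C : R, (0 < C)%R /\
     forall T : operator X (ell_infty R k), cc T <= C%:E * wk_op (adjoint T);
   (* (iii) *)
   exists C : R, (0 < C)%R /\
     forall (x : nat -> X) (f : nat -> dual X),
       weakly_null x -> (forall n, unit_ball X (x n)) -> bounded_fun f ->
       limn_esup (fun n => (rnorm (f n (x n)))%:E) <= C%:E * wk (range f);
   (* (iv) *)
   exists C : R, (0 < C)%R /\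
     forall f : nat -> dual X, bounded_fun f ->
       ca_rho_star f <= C%:E * delta f;
   (* (v) *)
   exists C : R, (0 < C)%R /\
     forall f : nat -> dual X, bounded_fun f ->
       ca_rho_star_tilde f <= C%:E * wk (range f);
   (* (vi) *)
   exists C : R, (0 < C)%R /\
     forall (Y : completeNormedModType (scalars R k)) (T : operator X Y),
       cc T <= C%:E * wk_op T;
   (* (vii) *)
   exists C : R, (0 < C)%R /\
     forall T : operator X (ell_infty R k), cc T <= C%:E * wk_op T].
Proof.
have scale (C : R) (a b : \bar R) (c w : R) : (0 < C)%R ->
    a <= C%:E * b -> b <= (c * w)%:E -> a <= (C * c * w)%:E.
  move=> C0 ab bw; apply: le_trans ab _; rewrite -mulrA EFinM.
  by apply: lee_wpmul2l => //; rewrite lee_fin ltW.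
tfae.
- move=> [C [C0 XC]]; exists C; split=> // T; exact: XC.
- move=> [C [C0 XC]]; exists (20 * (C * 4) + 2)%R; split.
    by rewrite addr_gt0 ?mulr_gt0.
  apply: weakly_null_bound_of_cc => [|T w w0 Tw]; first by rewrite mulr_gt0.
  apply: scale (XC T) _ => //.
  (* one factor 2 is lost in passing to the adjoint, the other one in making the
     bound of [wk_op T] strict *)
  have -> : (4 * w = 2 * (2 * w))%R by lra.
  by apply: wk_adjoint_le; apply: le_lt_trans Tw _; rewrite lte_fin; lra.
- move=> [C [C0 XC]]; exists (2 * C + 2)%R; split.
    by rewrite addr_gt0 ?mulr_gt0.
  exact: ca_rho_star_le_of_weakly_null_bound.
- move=> [C [C0 XC]]; exists (C * 9)%R; split; first by rewrite mulr_gt0.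
  exact: ca_rho_star_tilde_le_of_delta.
- move=> [C [C0 XC]]; exists (2 * (C + 1) * 2)%R; split.
    by rewrite !mulr_gt0 ?addr_gt0.
  move=> Y T; apply: lee_mulr_limit; first by rewrite !mulr_gt0 ?addr_gt0.
    exact: wk_op_ge0.
  move=> w /wk_adjoint_le Tw; apply: scale Tw.
    by rewrite mulr_gt0 ?addr_gt0.
  apply: cc_le_of_weakly_null_bound; first by rewrite addr_gt0.
  exact: weakly_null_bound_of_tilde.
- move=> [C [C0 XC]]; exists C; split=> // T; exact: XC.
- move=> [C [C0 XC]]; exists (2 * (20 * C + 2))%R; split.
    by rewrite mulr_gt0 ?addr_gt0 ?mulr_gt0.
  move=> Y T; apply: cc_le_of_weakly_null_bound.
    by rewrite addr_gt0 ?mulr_gt0.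
  apply: weakly_null_bound_of_cc => // {T}T w w0 Tw.
  have := @scale C _ _ 1%R w C0 (XC T); rewrite mul1r mulr1; exact.
Qed.
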